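(* Let $\varphi:\mathbb{P}^N\dashrightarrow\mathbb{P}^N$ be a dominant rational map defined over $\overline{\mathbb{Q}}$ with dynamical degree $\delta_\varphi>1$, assume that the quantity $\ell_\varphi$ exists, and let $P\in\mathbb{P}^N(\overline{\mathbb{Q}})_\varphi$. Then: (a) $0\le\hat h_\varphi(P)\le\infty$. (b) $\hat h_\varphi(\varphi(P))=\delta_\varphi\,\hat h_\varphi(P)$. (c) If $P$ is preperiodic for $\varphi$, then $\hat h_\varphi(P)=0$. (d) If $\hat h_\varphi(P)>0$, then $\alpha_\varphi(P)=\delta_\varphi$.
   Context: For a dominant rational map $\varphi:\mathbb{P}^N\dashrightarrow\mathbb{P}^N$, $\deg\varphi$ is the common degree of homogeneous polynomials without common factor defining $\varphi$, and $\delta_\varphi=\lim_{n\to\infty}(\deg\varphi^n)^{1/n}$ is the dynamical degree (the limit exists). Define $\ell_\varphi=\inf\{\ell\ge0:\sup_{n\ge1}\deg(\varphi^n)/(n^{\ell}\delta_\varphi^n)<\infty\}$; ''$\ell_\varphi$ exists'' means that the set over which the infimum is taken is nonempty. $Z(\varphi)$ is the indeterminacy locus, $\mathcal{O}_\varphi(P)=\{\varphi^n(P):n\ge0\}$, and $\mathbb{P}^N(\overline{\mathbb{Q}})_\varphi=\{P\in\mathbb{P}^N(\overline{\mathbb{Q}}):\mathcal{O}_\varphi(P)\cap Z(\varphi)=\emptyset\}$. $P$ is preperiodic if $\mathcal{O}_\varphi(P)$ is finite. Let $h:\mathbb{P}^N(\overline{\mathbb{Q}})\to[0,\infty)$ be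 the absolute logarithmic Weil height. The canonical height is $\hat h_\varphi(P)=\limsup_{n\to\infty}n^{-\ell_\varphi}\delta_\varphi^{-n}h(\varphi^n(P))\in\mathbb{R}\cup\{\pm\infty\}$, and the arithmetic degree is $\alpha_\varphi(P)=\limsup_{n\to\infty}h(\varphi^n(P))^{1/n}$, with the convention $\alpha_\varphi(P)=1$ if $h(\varphi^n(P))=0$ for all sufficiently large $n$. *)

(* Defs.v *)
From HB Require Import structures.
From mathcomp Require Import all_boot all_order all_algebra all_field.
From mathcomp Require Import finmap mpoly.
From mathcomp Require Import boolp classical_sets functions cardinality fsbigop.
From mathcomp Require Import reals ereal topology normedtype sequences exp.

Set Implicit Arguments.
Unset Strict Implicit.
Unset Printing Implicit Defensive.

Import Order.TTheory GRing.Theory Num.Theory.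
Import numFieldNormedType.Exports.

Local Open Scope classical_set_scope.
Local Open Scope ring_scope.
Local Open Scope quotient_scope.

(* Throughout, Qbar is algC. *)

Section ProjectiveSpace.
Variable N : nat.

Definition nzvec := {x : 'rV[algC]_N.+1 | x != 0}.

Definition proj_rel (x y : nzvec) : bool :=
  `[< exists2 c : algC, c != 0 & val x = c *: val y >].

Lemma proj_rel_equiv : equiv_class_of proj_rel.
Proof.
split=> [x | x y | y x z].
- by apply/asboolP; exists 1; rewrite ?oner_eq0 ?scale1r.
- apply/idP/idP => /asboolP[c c0 e]; apply/asboolP; exists c^-1;
    by rewrite ?invr_eq0 // e scalerA mulVf // scale1r.
- move=> /asboolP[c c0 e] /asboolP[d d0 f]; apply/asboolP.
  by exists (c * d); rewrite ?mulf_neq0 // e f scalerA.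
Qed.

Canonical proj_equiv := EquivRelPack proj_rel_equiv.

Definition proj := {eq_quot proj_equiv}.

End ProjectiveSpace.

(* [coords P] is an arbitrary vector of homogeneous coordinates of [P]. *)
Definition coords N (P : proj N) : 'rV[algC]_N.+1 := val (repr P).

Definition forms N := N.+1.-tuple {mpoly algC[N.+1]}.

Definition homogeneous_forms N (d : nat) (F : forms N) : Prop :=
  forall i, tnth F i \is d.-homog.

(* In particular the forms are not all zero. *)
Definition no_common_factor N (F : forms N) : Prop :=
  forall G : {mpoly algC[N.+1]},
    (forall i, exists Q, tnth F i = Q * G) -> G \is a GRing.unit.

Record ratmap (N : nat) := RatMap {
  ratmap_deg : nat;
  ratmap_forms : forms N;
  ratmap_homog : homogeneous_forms ratmap_deg ratmap_forms;
  ratmap_coprime : no_common_factor ratmap_forms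
}.

Definition eval_forms N (F : forms N) (x : 'rV[algC]_N.+1) : 'rV[algC]_N.+1 :=
  \row_i (tnth F i).@[fun j => x 0 j].

(* As the forms of a [ratmap] have no common factor, their common zeros are
   exactly the points where the map is not defined. *)
Definition indeterminacy N (phi : ratmap N) : set (proj N) :=
  [set P | eval_forms (ratmap_forms phi) (coords P) = 0].

(* The value is the junk point [P] when [P] is in the indeterminacy locus. *)
Definition app N (phi : ratmap N) (P : proj N) : proj N :=
  if insub (eval_forms (ratmap_forms phi) (coords P)) is Some y
  then \pi_(proj N) (y : nzvec N) else P.

(* The image of the domain of definition is Zariski dense: no nonzero form
   vanishes on it. *)
Definition dominant N (phi : ratmap N) : Prop :=
  forall (d : nat) (G : {mpoly algC[N.+1]}), G \is d.-homog ->
    (forall P, ~ indeterminacy phi P ->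
       G.@[fun j => coords (app phi P) 0 j] = 0) ->
    G = 0.

Fixpoint iter_forms N (F : forms N) (n : nat) : forms N :=
  if n is m.+1 then [tuple tnth F i \mPo iter_forms F m | i < N.+1]
  else [tuple 'X_i | i < N.+1].

(* The degree of the rational map defined by nonzero forms [F] of equal
   degree, i.e. the degree of its expression [G] without common factor. *)
Definition map_degree N (F : forms N) : nat :=
  get [set e : nat | exists G : forms N,
    [/\ homogeneous_forms e G, no_common_factor G &
        exists2 H : {mpoly algC[N.+1]}, H != 0 &
          forall i, tnth F i = H * tnth G i]].

Definition deg_iter N (phi : ratmap N) (n : nat) : nat :=
  map_degree (iter_forms (ratmap_forms phi) n).

Definition orbit N (phi : ratmap N) (P : proj N) : set (proj N) :=
  [set iter n (app phi) P | n in [set: nat]].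

Definition good_orbit N (phi : ratmap N) : set (proj N) :=
  [set P | orbit phi P `&` indeterminacy phi = set0].

Definition preperiodic N (phi : ratmap N) (P : proj N) : Prop :=
  finite_set (orbit phi P).

(* If the limit did not exist, [limn] would return 0. *)
Definition dyn_degree (R : realType) N (phi : ratmap N) : R :=
  limn (fun n : nat => ((deg_iter phi n)%:R `^ n%:R^-1 : R)).
Arguments dyn_degree R {N} phi.

Definition ell_set (R : realType) N (phi : ratmap N) : set R :=
  [set l : R | 0 <= l /\
    (ereal_sup [set ((deg_iter phi n)%:R /
                      (n%:R `^ l * dyn_degree R phi ^+ n))%:E
               | n in [set n : nat | (1 <= n)%N]] < +oo)%E].

Arguments ell_set R {N} phi.

Definition ell (R : realType) N (phi : ratmap N) : R := inf (ell_set R phi).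
Arguments ell R {N} phi.

Section Height.
Variable R : realType.

Definition absolute_value (K : fieldType) (v : K -> R) : Prop :=
  [/\ forall x, 0 <= v x,
      forall x, v x = 0 <-> x = 0,
      forall x y, v (x * y) = v x * v y &
      forall x y, v (x + y) <= v x + v y].

Definition padic_abs (p : nat) (q : rat) : R :=
  if q == 0 then 0
  else p%:R ^+ logn p `|denq q| / p%:R ^+ logn p `|numq q|.

Definition places_rat : set (rat -> R) :=
  [set fun q => `|ratr q|] `|` [set padic_abs p | p in [set p | prime p]].

Definition restr_rat (K : fieldType) (v : K -> R) : rat -> R :=
  fun q => v (ratr q).

Definition places (K : fieldExtType rat) : set (K -> R) :=
  [set v | absolute_value v /\ places_rat (restr_rat v)].
Arguments places K : clear implicits.

(* A fixed extension of the place u of Q to Qbar. *)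
Definition ext_place (u : rat -> R) : algC -> R :=
  get [set w : algC -> R | absolute_value w /\ restr_rat w = u].

(* The local degree [K_v : Q_v], as the number of embeddings of K into an
   algebraic closure of Q_v which induce v. Such embeddings take their values
   in the algebraic numbers, whence Qbar with the fixed extension of v|_Q. *)
Definition local_degree (K : fieldExtType rat) (v : K -> R) : nat :=
  #|` fset_set [set s : K -> algC | range (fun f : {rmorphism K -> algC} =>
                                            (f : K -> algC)) s /\
                  ext_place (restr_rat v) \o s = v] |.

Definition number_field_height (K : fieldExtType rat) N (x : 'rV[K]_N.+1) : R :=
  (\dim {:K})%:R^-1 *
  \sum_(v \in places K)
    (local_degree v)%:R * ln (\big[Num.max/0]_i v (x 0 i)).

(* The common value of the heights of P over all number fields K containing
   homogeneous coordinates x of P. *)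
Definition weil_height N (P : proj N) : R :=
  get [set h : R | exists (K : fieldExtType rat) (f : {rmorphism K -> algC})
                     (x : 'rV[K]_N.+1) (nz_fx : map_mx f x != 0),
         \pi_(proj N) (Sub (map_mx f x) nz_fx : nzvec N) = P /\
         h = number_field_height x].

End Height.
Arguments weil_height R {N} P.

Section CanonicalHeight.
Variables (R : realType) (N : nat) (phi : ratmap N) (P : proj N).

Definition height_iter (n : nat) : R := weil_height R (iter n (app phi) P).

Definition canonical_height : \bar R :=
  limn_esup (fun n : nat => (n%:R `^ (- ell R phi) *
                             dyn_degree R phi ^- n * height_iter n)%:E).

Definition arithmetic_degree : \bar R :=
  if `[< \forall n \near \oo, height_iter n = 0 >] then 1%E
  else limn_esup (fun n : nat => (height_iter n `^ n%:R^-1)%:E).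

End CanonicalHeight.
Arguments canonical_height R {N} phi P.
Arguments arithmetic_degree R {N} phi P.

(* Main.v *)
Require Import Defs.
From HB Require Import structures.
From mathcomp Require Import all_fingroup all_boot all_order all_algebra all_field.
From mathcomp Require Import finmap mpoly.
From mathcomp Require Import boolp classical_sets functions cardinality fsbigop.
From mathcomp Require Import reals ereal topology normedtype sequences exp.
From mathcomp Require Import ring lra.

(* The analytic input is [h (G Q) <= deg G * h Q + C] for forms [G]; applied to a
   reduced expression of [phi^k] with [deg (phi^k) ^ (1 / k)] close to the
   dynamical degree and iterated, it gives [alpha <= delta], while a positive
   canonical height gives [h (phi^n P) > c * delta ^ n] infinitely often.

   For the heights, choose for each place [u] of the rationals an extension [w_u]
   to algC (for a prime [p]: a maximal subring of algC not containing [1 / p] is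
   a valuation ring of rank one).  Every embedding of a number field [K] into algC
   is [i \o g \o j] with [j : K -> L], [L] a fixed normal number field embedded by
   [i], and [g] in the Galois group, so the height of [x] over [K] is the average
   over [g] of the sum over [u] of [ln (max_k w_u (i (g (j x_k))))].  In this form
   it only depends on the coordinates in [L], and the product formula for [z] in
   [L] is the one of the rationals applied to the norm of [z]. *)

Set Implicit Arguments.
Unset Strict Implicit.
Unset Printing Implicit Defensive.
Import Order.TTheory GRing.Theory Num.Theory.
Import numFieldNormedType.Exports.
Local Open Scope classical_set_scope.
Local Open Scope ring_scope.
Local Open Scope quotient_scope.

(** * Extending the places of the rationals to algC *)

(** [ext_place], [weil_height] and [map_degree] are choices made by [get], which carry no
    information until an element is exhibited. This is why an extension of every rational place to
    algC has to be constructed, and why the height estimates are proved for whatever representation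
    the choice returns. The archimedean extension is the modulus of algC, read in [R] through
    rational cuts. Places of a number field [K] are seen only as pullbacks of the chosen extensions
    under embeddings; counting automorphisms of [L] instead of embeddings of [K] makes all fields
    comparable inside one [L]. The main constraint is uniformity: [L] varies with the points
    compared, while the constant [C] may not. Sums over all places are read as sums over [n < M] for
    all large [M], since almost every place is trivial on given nonzero numbers. The factor
    [n ^ - ell] enters through [ell >= 0], which makes it at most 1 and decreasing, and through the
    ratio of its consecutive values, which tends to 1. *)

Lemma eq_le_eps (R : realType) (x y C : R) :
  (forall e : rat, 0 < e <= 1 -> `|x - y| <= C * ratr e) -> x = y.
Proof.
move=> h; apply/eqP; rewrite -subr_eq0 -normr_eq0; apply/negPn/negP => xy.
have d0 : 0 < `|x - y| by rewrite lt_def xy normr_ge0.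
have C0 : 0 < C.
  have := h 1; rewrite rmorph1 mulr1 lexx ltr01 => /(_ isT).
  exact: lt_le_trans.
set n := (Num.truncn (C / `|x - y|)).+1.
have hn : C < `|x - y| * n%:R.
  by rewrite mulrC -ltr_pdivrMr //; apply: truncnS_gt.
have := h n%:R^-1; rewrite invr_gt0 ltr0n /= invf_le1 ?ltr0n // ler1n => /(_ isT).
rewrite fmorphV /= ratr_nat ler_pdivlMr ?ltr0n //.
by move=> /(lt_le_trans hn); rewrite ltxx.
Qed.

(** * The archimedean absolute value on algC *)

Section ArchimedeanPlace.
Variable R : realType.

Lemma rat_approx (a : algC) (e : rat) : 0 <= a -> 0 < e ->
  exists q : rat, 0 <= q /\ ratr q <= a <= ratr (q + e).
Proof.
move=> a0 e0; set n := (Num.truncn e^-1).+1.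
have n0 : (0 < n%:R :> rat) by rewrite ltr0n.
have ne : n%:R^-1 <= e.
  by rewrite -[e]invrK lef_pV2 ?posrE ?invr_gt0 // ltW // truncnS_gt.
have an0 : 0 <= a * n%:R by rewrite mulr_ge0 ?ler0n.
exists ((Num.truncn (a * n%:R))%:R / n%:R); split.
  by rewrite divr_ge0 ?ler0n.
have nC : 0 < n%:R :> algC by rewrite ltr0n.
apply/andP; split.
  rewrite fmorph_div /= !ratr_nat ler_pdivrMr //.
  by rewrite truncn_le.
apply: (@le_trans _ _ (ratr ((Num.truncn (a * n%:R))%:R / n%:R + n%:R^-1))).
  rewrite -[X in _ + X]mul1r -mulrDl fmorph_div rmorphD rmorph1 /= !ratr_nat ler_pdivlMr //.
  by rewrite natr1 ltW // real_truncnS_gt // ger0_real.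
by rewrite ler_rat lerD2l.
Qed.

(** A Dedekind cut, which transports real algebraic numbers to [R]; it is applied to moduli, hence
    to nonnegative [a]. *)
Definition real_of_alg (a : algC) : R :=
  sup [set x | exists2 q : rat, ratr q <= a & x = ratr q].

Lemma real_of_alg_bounds (a : algC) (q r : rat) : 0 <= a ->
  ratr q <= a <= ratr r -> ratr q <= real_of_alg a <= ratr r.
Proof.
move=> a0 /andP[qa ar]; apply/andP; split.
  apply: ub_le_sup; last by exists q.
  exists (ratr r) => _ [s sa ->]; rewrite ler_rat.
  by have := le_trans sa ar; rewrite ler_rat.
apply: ge_sup; first by exists (ratr q); exists q.
move=> _ [s sa ->]; rewrite ler_rat.
by have := le_trans sa ar; rewrite ler_rat.
Qed.

Lemma real_of_alg_rat (q : rat) : 0 <= q -> real_of_alg (ratr q) = ratr q.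
Proof.
move=> q0; apply/eqP; rewrite eq_le andbC.
by apply: real_of_alg_bounds; rewrite ?lexx // ler0q.
Qed.

Lemma real_of_alg_ge0 a : 0 <= a -> 0 <= real_of_alg a.
Proof.
move=> a0; have [q [q0 /(real_of_alg_bounds a0) /andP[h _]]] := rat_approx a0 ltr01.
by apply: le_trans h; rewrite ler0q.
Qed.

Lemma real_of_algD a b : 0 <= a -> 0 <= b ->
  real_of_alg (a + b) = real_of_alg a + real_of_alg b.
Proof.
move=> a0 b0; apply: (@eq_le_eps _ _ _ 2) => e /andP[e0 _].
have [q [q0 qa]] := rat_approx a0 e0.
have [r [r0 rb]] := rat_approx b0 e0.
have /andP[] := real_of_alg_bounds a0 qa.
have /andP[] := real_of_alg_bounds b0 rb.
have /andP[] : ratr (q + r) <= real_of_alg (a + b) <= ratr ((q + e) + (r + e)).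
  apply: real_of_alg_bounds; first exact: addr_ge0.
  by move: qa rb => /andP[? ?] /andP[? ?]; rewrite !(rmorphD _ q) !(rmorphD _ (q + e)) !lerD.
rewrite !rmorphD /= => *; rewrite ler_norml; lra.
Qed.

Lemma real_of_algM a b : 0 <= a -> 0 <= b ->
  real_of_alg (a * b) = real_of_alg a * real_of_alg b.
Proof.
(* Both sides lie between [q * r] and [(q + e) * (r + e)], which differ by [e * (q + r + e)]; as
   [e <= 1], this is at most [e] times the given constant. *)
move=> a0 b0; apply: (@eq_le_eps _ _ _ (real_of_alg a + real_of_alg b + 1)).
move=> e /andP[e0 e1].
have [q [q0 qa]] := rat_approx a0 e0.
have [r [r0 rb]] := rat_approx b0 e0.
have /andP[] := real_of_alg_bounds a0 qa.
have /andP[] := real_of_alg_bounds b0 rb.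
have /andP[] : ratr (q * r) <= real_of_alg (a * b) <= ratr ((q + e) * (r + e)).
  apply: real_of_alg_bounds; first exact: mulr_ge0.
  move: qa rb => /andP[? ?] /andP[? ?]; rewrite !(rmorphM _ q) !(rmorphM _ (q + e)) /=.
  by rewrite !ler_pM // ?ler0q.
have : 0 <= ratr q :> R by rewrite ler0q.
have : 0 <= ratr r :> R by rewrite ler0q.
have : 0 < ratr e :> R by rewrite ltr0q.
have : ratr e <= 1 :> R by rewrite -(rmorph1 (ratr : {rmorphism rat -> R})) ler_rat.
rewrite !rmorphM !rmorphD /=.
move: (ratr e) (ratr q) (ratr r) (real_of_alg a) (real_of_alg b) (real_of_alg _).
move=> {a b a0 b0 q r q0 r0 qa rb e e0 e1} e q r a b c e1 e0 r0 q0 h1 h2 h3 h4 h5 h6.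
have : q * r <= a * b by rewrite ler_pM.
have : a * b <= (q + e) * (r + e) by rewrite ler_pM //; lra.
by move=> ? ?; rewrite ler_norml; nra.
Qed.

Lemma archimedean_place : exists w : algC -> R,
  absolute_value w /\ restr_rat w = (fun q => `|ratr q|).
Proof.
exists (fun x => real_of_alg `|x|); split; last first.
  apply/funext => q; rewrite /restr_rat -[X in real_of_alg X](_ : ratr `|q| = _).
    by rewrite real_of_alg_rat // ratr_norm.
  by rewrite ratr_norm.
split=> [x|x|x y|x y].
- by apply: real_of_alg_ge0.
- split=> [h|->]; last first.
    by rewrite normr0 -(rmorph0 (ratr : {rmorphism rat -> algC})) real_of_alg_rat // rmorph0.
  apply/eqP/negPn/negP => x0.
  have : real_of_alg (`|x| * `|x^-1|) = 1.
    rewrite -normrM divff // normr1 -(rmorph1 (ratr : {rmorphism rat -> algC})).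
    by rewrite real_of_alg_rat // rmorph1.
  by rewrite real_of_algM // h mul0r => /esym/eqP; rewrite oner_eq0.
- by rewrite normrM real_of_algM.
- rewrite -real_of_algD //.
  have h : 0 <= `|x| + `|y| - `|x + y| by rewrite subr_ge0 ler_normD.
  (* The triangle inequality follows from additivity, since the defect is nonnegative and so has a
     nonnegative image. *)
  have -> : `|x| + `|y| = `|x + y| + (`|x| + `|y| - `|x + y|) by ring.
  by rewrite real_of_algD // lerDl real_of_alg_ge0.
Qed.

End ArchimedeanPlace.

(** * Maximal subrings avoiding the inverse of [c] are valuation rings *)

Section MaximalRing.
Variables (K : fieldType) (c : K).

Definition subring_avoiding (A : set K) : Prop :=
  [/\ A 1, forall x y, A x -> A y -> A (x - y),
      forall x y, A x -> A y -> A (x * y) & ~ A c^-1].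

Definition maximal_avoiding (A : set K) : Prop :=
  subring_avoiding A /\
  forall B, subring_avoiding B -> A `<=` B -> B `<=` A.

Lemma maximal_avoiding_exists (A0 : set K) :
  subring_avoiding A0 -> exists A, maximal_avoiding A.
Proof.
move=> A0P.
pose P (A : set K) := A = set0 \/ subring_avoiding A.
have [F FP Ftot|A [PA Amax]] := @Zorn_bigcup K P.
  have [hF|] := pselect (exists2 X, F X & X !=set0); last first.
    move=> hF; left; rewrite -subset0 => x [X FX Xx].
    by apply: hF; exists X => //; exists x.
  case: hF => X0 FX0 [x0 X0x0].
  have Fsub X x : F X -> X x -> subring_avoiding X.
    by move=> FX Xx; case: (FP _ FX) => // Xe; move: Xx; rewrite Xe.
  have F2 x y : (\bigcup_(X in F) X) x -> (\bigcup_(X in F) X) y ->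
      exists X, [/\ F X, X x & X y].
    move=> [X FX Xx] [Y FY Yy].
    by case: (Ftot _ _ FX FY) => XY; [exists Y|exists X]; split=> //; apply: XY.
  right; split.
  - by exists X0 => //; have [] := Fsub _ _ FX0 X0x0.
  - move=> x y hx hy; have [X [FX Xx Xy]] := F2 _ _ hx hy.
    by exists X => //; have [_ h _ _] := Fsub _ _ FX Xx; apply: h.
  - move=> x y hx hy; have [X [FX Xx Xy]] := F2 _ _ hx hy.
    by exists X => //; have [_ _ h _] := Fsub _ _ FX Xx; apply: h.
  - by move=> [X FX Xx]; have [_ _ _ h] := Fsub _ _ FX Xx; apply: h.
have A00 : A0 !=set0 by exists 1; case: A0P.
case: PA => [A_0|PA].
  case: (Amax A0); last by right.
  by rewrite A_0 properEneq; split; [apply/eqP => h; move: A00; rewrite -h => -[]|exact: sub0set].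
exists A; split=> // B PB AB; apply: contrapT => BA.
by apply: (Amax B); [split|right].
Qed.

Variable A : set K.
Hypothesis Amax : maximal_avoiding A.

Let A1 : A 1. Proof. by case: Amax => -[]. Qed.
Let AB x y : A x -> A y -> A (x - y). Proof. by case: Amax => -[_ h _ _] _; apply: h. Qed.
Lemma maximal_avoidingM x y : A x -> A y -> A (x * y).
Proof. by case: Amax => -[_ _ h _] _; apply: h. Qed.
Let AM := maximal_avoidingM.
Let Ac : ~ A c^-1. Proof. by case: Amax => -[]. Qed.
Lemma maximal_avoiding0 : A 0. Proof. by rewrite -(subrr 1); apply: AB. Qed.
Let A0 := maximal_avoiding0.
Lemma maximal_avoidingN x : A x -> A (- x).
Proof. by move=> hx; rewrite -sub0r; apply: AB. Qed.
Let AN := maximal_avoidingN.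
Lemma maximal_avoidingD x y : A x -> A y -> A (x + y).
Proof. by move=> hx hy; rewrite -[y]opprK; apply: AB => //; apply: AN. Qed.
Let AD := maximal_avoidingD.
Lemma maximal_avoidingX x n : A x -> A (x ^+ n).
Proof. by move=> hx; elim: n => [|n IH]; rewrite ?expr0 // exprS; apply: AM. Qed.
Let AX := maximal_avoidingX.
Lemma maximal_avoiding_sum (I : Type) (r : seq I) (P : pred I) (F : I -> K) :
  (forall i, P i -> A (F i)) -> A (\sum_(i <- r | P i) F i).
Proof. by move=> h; apply: (big_ind A). Qed.
Let Asum := maximal_avoiding_sum.
Lemma maximal_avoiding_nat n : A n%:R.
Proof. by elim: n => [|n IH] //; rewrite -natr1; apply: AD. Qed.

Definition coefs_in (f : {poly K}) := forall i, A f`_i.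

(** The values [f.[x]] form the ring [A[x]], strictly larger than [A]; by maximality it cannot avoid
    [c^-1]. *)
Lemma maximal_avoiding_adjoin x : ~ A x ->
  exists2 f, coefs_in f & f.[x] = c^-1.
Proof.
move=> Ax; apply: contrapT => hx.
case: Amax => _ /(_ [set y | exists2 f, coefs_in f & f.[x] = y]) h.
apply: Ax; apply: h; last 1 first.
- exists 'X; last by rewrite hornerX.
  by move=> i; rewrite coefX; case: (_ == _).
- split=> //.
  + exists 1; last by rewrite hornerC.
    by move=> i; rewrite coef1; case: (_ == _).
  + move=> _ _ [f fA <-] [g gA <-]; exists (f - g); last by rewrite hornerD hornerN.
    by move=> i; rewrite coefB; apply: AB.
  + move=> _ _ [f fA <-] [g gA <-]; exists (f * g); last by rewrite hornerM.
    by move=> i; rewrite coefM; apply: Asum => j _; apply: AM.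
- move=> y Ay; exists y%:P; last by rewrite hornerC.
  by move=> i; rewrite coefC; case: (_ == _).
Qed.

Hypotheses (c0 : c != 0) (cA : A c).

(* If [1 - c * b] were not a unit of [A], clearing denominators in
   [c^-1 \in A[1 / (1 - c * b)]] would give [c^-1 \in A]. *)
Lemma maximal_avoiding_unit b : A b -> A (1 - c * b)^-1.
Proof.
move=> Ab; apply: contrapT => hu; have [f fA fu] := maximal_avoiding_adjoin hu.
set u := 1 - c * b in hu fu.
have Au : A u by apply: AB => //; apply: AM.
have u0 : u != 0 by apply/eqP => u0; apply: hu; rewrite u0 invr0.
have : A (c^-1 * u ^+ size f).
  rewrite -fu horner_coef mulr_suml; apply: Asum => i _.
  rewrite -mulrA; apply: AM; first exact: fA.
  by rewrite exprVn mulrC -expfB //; apply: AX.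
have [d Ad ->] : exists2 d, A d & u ^+ size f = 1 - c * d.
  elim: (size f) => [|n [d Ad dE]]; first by exists 0; rewrite ?mulr0 ?subr0.
  exists (b + u * d); first by apply: AD => //; apply: AM.
  by rewrite exprS dE /u; ring.
rewrite mulrBr mulr1 mulKf // => h; apply: Ac.
by rewrite -[_^-1](subrK d); apply: AD.
Qed.

(** Let [n = size f - 1]. Multiplying [g.[x^-1] = c^-1] by [x ^ n] expresses
    [x ^ n * (1 - c * g_0) / c] through lower powers of [x], all with nonnegative exponent since
    [size g <= size f]. As [1 - c * g_0] is a unit of [A], the top term of [f] can be replaced by
    lower ones. *)
Lemma maximal_avoiding_reduce x f g : x != 0 -> coefs_in f -> coefs_in g ->
  f.[x] = c^-1 -> g.[x^-1] = c^-1 -> (size g <= size f)%N ->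
  exists2 h, coefs_in h & (size h < size f)%N /\ h.[x] = c^-1.
Proof.
move=> x0 fA gA fx gx sgf.
have [n nE] : exists n, size f = n.+1.
  case sf : (size f) => [|n]; last by exists n.
  move/eqP: sf; rewrite size_poly_eq0 => /eqP f0; move: fx.
  by rewrite f0 horner0 => /esym/eqP; rewrite invr_eq0 (negPf c0).
set u := 1 - c * g`_0.
have Au : A u^-1 by apply: maximal_avoiding_unit.
have u0 : u != 0.
  apply/eqP => u0; apply: Ac; have -> : c^-1 = g`_0 => //.
  by apply: (mulfI c0); rewrite mulfV //; apply/eqP; rewrite -subr_eq0 -/u u0.
pose h := \poly_(i < n) (f`_i + f`_n * (c * u^-1) * g`_(n - i)).
exists h.
  move=> i; rewrite coef_poly; case: ifP => // _; apply: AD => //.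
  by do ![apply: AM => //].
split; first by rewrite nE ltnS size_poly.
have gE : \sum_(i < n) g`_(n - i) * x ^+ i = x ^+ n * (u / c).
  have : \sum_(i < n.+1) g`_i * x^-1 ^+ i = c^-1.
    by rewrite -gx (horner_coef_wide _ (n := n.+1)) // -nE.
  rewrite big_ord_recl expr0 mulr1 => /eqP; rewrite eq_sym -subr_eq => /eqP e.
  have -> : u / c = c^-1 - g`_0 by rewrite /u mulrBl mul1r mulrAC mulfV // mul1r.
  rewrite -e subKr mulr_sumr (reindex_inj rev_ord_inj) /=; apply: eq_bigr => i _.
  rewrite /bump leq0n add1n subKn // mulrCA exprVn -expfB_cond ?(negPf x0) ?ltn_ord //.
rewrite /h horner_poly -fx (horner_coef_wide _ (n := n.+1)) ?nE // big_ord_recr /=.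
under eq_bigr do rewrite mulrDl.
rewrite big_split /=; congr (_ + _).
under eq_bigr do rewrite -mulrA.
rewrite -mulr_sumr gE; by field; apply/andP.
Qed.

(** If both failed, [c^-1] would be a polynomial in [x] and one in [x^-1]; reducing whichever is
    longer by means of the other never stops. *)
Lemma maximal_avoiding_valuation x : A x \/ A x^-1.
Proof.
have [->|x0] := eqVneq x 0; first by left.
apply: contrapT => /not_orP[hx hx'].
have [f fA fx] := maximal_avoiding_adjoin hx.
have [g gA gx] := maximal_avoiding_adjoin hx'.
have [n] := ubnP (size f + size g)%N; elim: n f g fA gA fx gx => // n IH f g.
move=> fA gA fx gx; have [sgf|sfg] := leqP (size g) (size f) => sn.
  have [h hA [hs hE]] := maximal_avoiding_reduce x0 fA gA fx gx sgf.
  by apply: (IH h g) => //; move: sn; rewrite ltnS; apply: leq_trans; rewrite ltn_add2r.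
have x0' : x^-1 != 0 by rewrite invr_eq0.
rewrite -[x]invrK in fx.
have [h hA [hs hE]] := maximal_avoiding_reduce x0' gA fA gx fx (ltnW sfg).
rewrite invrK in fx.
by apply: (IH f h) => //; move: sn; rewrite ltnS; apply: leq_trans; rewrite ltn_add2l.
Qed.

(** With [x / y] in [A], an inverse of [x + y] in [A] would give [y^-1 = (x / y + 1) / (x + y)] in
    [A]. As [0^-1 = 0], zero passes for a unit in this formulation, whence the second
    alternative. *)
Lemma maximal_avoiding_nonunitD x y : ~ (A x /\ A x^-1) -> ~ (A y /\ A y^-1) ->
  A x -> A y -> ~ (A (x + y) /\ A (x + y)^-1) \/ x + y = 0.
Proof.
wlog : x y / A (x / y).
  move=> wl hx hy Ax Ay; have [h|] := maximal_avoiding_valuation (x / y); first exact: wl.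
  by rewrite invf_div addrC => h; apply: wl.
move=> Axy hx hy Ax Ay; have [->|xy0] := eqVneq (x + y) 0; [by right|left].
have [y0|y0] := eqVneq y 0; first by rewrite y0 addr0.
move=> [_ h]; apply: hy; split=> //.
have -> : y^-1 = (x / y + 1) * (x + y)^-1 by field; rewrite y0 xy0.
by apply: AM => //; apply: AD.
Qed.

End MaximalRing.

(** * The p-adic absolute value on the rationals *)

Section PadicAbs.
Variables (R : realType) (p : nat).
Hypothesis p_prime : prime p.

Let p0 : p%:R != 0 :> R. Proof. by rewrite pnatr_eq0 -lt0n prime_gt0. Qed.
Let pX0 n : p%:R ^+ n != 0 :> R. Proof. by rewrite expf_neq0. Qed.

(** Cross-multiplying with the reduced fraction balances the exponents of [p]; products can then be
    handled without reducing them. *)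
Lemma padic_abs_frac (a b : int) : a != 0 -> b != 0 ->
  padic_abs R p (a%:~R / b%:~R) = p%:R ^+ logn p `|b| / p%:R ^+ logn p `|a|.
Proof.
move=> a0 b0; set q : rat := _ / _.
have q0 : q != 0 by rewrite mulf_neq0 ?invr_eq0 ?intr_eq0.
rewrite /padic_abs (negPf q0).
have e : numq q * b = a * denq q.
  apply: (@intr_inj rat); rewrite !rmorphM /=.
  by rewrite numqE /q; field; rewrite intr_eq0.
have : (logn p `|numq q| + logn p `|b| = logn p `|a| + logn p `|denq q|)%N.
  rewrite -!lognM ?absz_gt0 ?numq_eq0 ?denq_neq0 // -!abszM; congr (logn p _).
  by rewrite e.
move=> h; apply/eqP; rewrite eqr_div // -!exprD; apply/eqP.
by congr (_ ^+ _); rewrite addnC -h addnC.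
Qed.

Lemma padic_absM x y : padic_abs R p (x * y) = padic_abs R p x * padic_abs R p y.
Proof.
have [->|x0] := eqVneq x 0; first by rewrite mul0r /padic_abs eqxx mul0r.
have [->|y0] := eqVneq y 0; first by rewrite mulr0 /padic_abs eqxx mulr0.
have nz z : z != 0 -> numq z != 0 by rewrite numq_eq0.
rewrite -[x]divq_num_den -[y]divq_num_den mulf_div -!rmorphM /=.
rewrite !padic_abs_frac ?mulf_neq0 ?nz ?denq_neq0 // !abszM.
rewrite !lognM ?absz_gt0 ?nz ?denq_neq0 // !exprD; field.
by rewrite !pX0.
Qed.

Lemma padic_abs0 : padic_abs R p 0 = 0. Proof. by rewrite /padic_abs eqxx. Qed.

Lemma padic_abs_gt0 x : x != 0 -> 0 < padic_abs R p x.
Proof.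
move=> x0; rewrite /padic_abs (negPf x0) divr_gt0 // exprn_gt0 //;
by rewrite ltr0n prime_gt0.
Qed.

Lemma padic_abs_ge0 x : 0 <= padic_abs R p x.
Proof.
have [->|x0] := eqVneq x 0; first by rewrite padic_abs0.
exact/ltW/padic_abs_gt0.
Qed.

Lemma padic_abs1 : padic_abs R p 1 = 1.
Proof.
by have := @padic_abs_frac 1 1 isT isT; rewrite divr1 rmorph1 => ->; rewrite divff.
Qed.

Lemma padic_absX x n : padic_abs R p (x ^+ n) = padic_abs R p x ^+ n.
Proof. by elim: n => [|n IH]; rewrite ?padic_abs1 // !exprS padic_absM IH. Qed.

Lemma padic_abs_int_le1 (a : int) : padic_abs R p a%:~R <= 1.
Proof.
have [->|a0] := eqVneq a 0; first by rewrite padic_abs0.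
have := @padic_abs_frac a 1 a0 isT; rewrite divr1 => ->.
by rewrite logn1 expr0 div1r invf_le1 ?exprn_gt0 ?ltr0n ?prime_gt0 // exprn_ege1 // ler1n prime_gt0.
Qed.

Lemma padic_abs_coprime (a : nat) : (0 < a)%N -> coprime p a -> padic_abs R p a%:R = 1.
Proof.
move=> a0 co; have := @padic_abs_frac a 1; rewrite divr1 => -> //; last by rewrite -lt0n.
by rewrite logn1 expr0 div1r /= logn_coprime // expr0 invr1.
Qed.

Lemma rat_padic_decomp (q : rat) : q != 0 -> exists s : bool, exists a b m k : nat,
  [/\ coprime p m, coprime p k, (0 < m)%N, (0 < k)%N &
     q = (-1) ^+ s * ((p%:R ^+ a * m%:R) / (p%:R ^+ b * k%:R))] /\
  padic_abs R p q = p%:R ^+ b / p%:R ^+ a.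
Proof.
move=> q0; have n0 : (0 < `|numq q|)%N by rewrite absz_gt0 numq_eq0.
have d0 : (0 < `|denq q|)%N by rewrite absz_gt0 denq_neq0.
have [m cm mE] := pfactor_coprime p_prime n0.
have [k ck kE] := pfactor_coprime p_prime d0.
exists (numq q < 0), (logn p `|numq q|), (logn p `|denq q|), m, k; split.
  have pos_of x y : (0 < x)%N -> x = (y * p ^ logn p x)%N -> (0 < y)%N.
    by case: y => // + h; rewrite h.
  split=> //; [exact: pos_of mE|exact: pos_of kE|].
  rewrite -[LHS]divq_num_den mulrA; congr (_ / _).
    rewrite {1}[numq q]intEsign rmorphM /= rmorph_sign; congr (_ * _).
    by rewrite -natrX -natrM mulnC -mE.
  by rewrite -natrX -natrM mulnC -kE -[in LHS](gtz0_abs (denq_gt0 q)).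
by rewrite /padic_abs (negPf q0).
Qed.

End PadicAbs.

(** * Units and value group of a valuation ring above [p] *)

Section PadicPlace.
Variables (R : realType) (K : numFieldType) (p : nat).
Hypothesis p_prime : prime p.

Let pC0 : p%:R != 0 :> K. Proof. by rewrite pnatr_eq0 -lt0n prime_gt0. Qed.

Lemma maximal_avoiding_prime : exists A : set K, maximal_avoiding (p%:R) A.
Proof.
apply: (@maximal_avoiding_exists _ _ [set x | exists z : int, x = z%:~R]); split.
- by exists 1.
- by move=> _ _ [a ->] [b ->]; exists (a - b); rewrite rmorphB.
- by move=> _ _ [a ->] [b ->]; exists (a * b); rewrite rmorphM.
- move=> [z zE]; have : (p%:Z * z)%:~R = 1 :> K by rewrite rmorphM /= -zE divff.
  move=> /eqP; rewrite -[1](rmorph1 (intr : int -> K)) eqr_int => /eqP.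
  move=> /(congr1 absz); rewrite abszM /= => /eqP; rewrite muln_eq1 => /andP[/eqP p1 _].
  by move: p_prime; rewrite p1.
Qed.

Variable A : set K.
Hypothesis Amax : maximal_avoiding p%:R A.

Let Anat n : A n%:R. Proof. exact: maximal_avoiding_nat Amax n. Qed.
Let AM x y : A x -> A y -> A (x * y). Proof. exact: maximal_avoidingM Amax x y. Qed.
Let AX x n : A x -> A (x ^+ n). Proof. exact: maximal_avoidingX Amax x n. Qed.
Let AN x : A x -> A (- x). Proof. exact: maximal_avoidingN Amax x. Qed.
Let A1 : A 1. Proof. exact: Anat 1. Qed.
Let Aval x : A x \/ A x^-1. Proof. exact: maximal_avoiding_valuation Amax pC0 (Anat p) x. Qed.

Let unit x := A x /\ A x^-1.
Let unitM x y : unit x -> unit y -> unit (x * y).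
Proof. by move=> [? ?] [? ?]; split; rewrite ?invfM; apply: AM. Qed.
Let unitV x : unit x -> unit x^-1.
Proof. by move=> [? ?]; split; rewrite ?invrK. Qed.
Let unitX x n : unit x -> unit (x ^+ n).
Proof. by move=> [? ?]; split; rewrite -?exprVn; apply: AX. Qed.

(** By Bezout some multiple [m * km] equals [1 + p * kn], which [maximal_avoiding_unit] inverts in
    [A]. *)
Let coprime_unit m : (0 < m)%N -> coprime p m -> A m%:R^-1.
Proof.
move=> m0 co; case: (egcdnP p m0) => km kn e _.
have {}e : (m * km)%:R = 1 - p%:R * - kn%:R :> K.
  move/eqP: co; rewrite gcdnC => co.
  by rewrite mulnC e co natrD natrM; ring.
have : A (m * km)%:R^-1.
  by rewrite e; apply: (maximal_avoiding_unit Amax) => //; apply: AN.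
rewrite natrM invfM => h.
have [km0|km0] := eqVneq (km%:R : K) 0.
  have: A 1 by [].
  have := maximal_avoiding_unit Amax pC0 (Anat p).
  move: e; rewrite natrM km0 mulr0 => /esym/eqP; rewrite mulrN opprK => /eqP e.
  have : (1 + p * kn)%:R = 0 :> K by rewrite natrD natrM.
  by move/eqP; rewrite pnatr_eq0.
have -> : m%:R^-1 = m%:R^-1 / km%:R * km%:R :> K by rewrite mulfVK.
exact: AM.
Qed.

(** Up to a unit of [A], [q] is [p ^ a / p ^ b]; if [a < b], multiplying by a power of [p] would put
    [p^-1] in [A]. *)
Lemma maximal_avoiding_rat (q : rat) : A (ratr q) <-> padic_abs R p q <= 1.
Proof.
have [->|q0] := eqVneq q 0.
  by rewrite padic_abs0 ler01 rmorph0; split=> // _; exact: (Anat 0).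
have [s [a [b [m [k [[cm ck m0 k0 qE] ->]]]]]] := rat_padic_decomp R p_prime q0.
have qC : ratr q = (-1) ^+ s * ((p%:R ^+ a * m%:R) / (p%:R ^+ b * k%:R)) :> K.
  by rewrite {1}qE rmorphM rmorph_sign fmorph_div /= !rmorphM /= !rmorphXn /= !ratr_nat.
have mC : m%:R != 0 :> K by rewrite pnatr_eq0 -lt0n.
have kC : k%:R != 0 :> K by rewrite pnatr_eq0 -lt0n.
have usign : unit ((-1) ^+ s).
  by apply: unitX; split; rewrite ?invrN1; apply: AN.
have um : unit m%:R by split=> //; apply: coprime_unit.
have uk : unit k%:R by split=> //; apply: coprime_unit.
have p1 : 1 < p%:R :> R by rewrite ltr1n prime_gt1.
have pa : 0 < p%:R ^+ a :> R by rewrite exprn_gt0 // (lt_trans ltr01).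
rewrite ler_pdivrMr // mul1r ler_eXn2l //.
set u : K := (-1) ^+ s * (m%:R / k%:R).
have uu : unit u by apply: unitM => //; apply: unitM => //; apply: unitV.
have uE : ratr q = u * (p%:R ^+ a / p%:R ^+ b) by rewrite qC /u invfM; ring.
split=> [Aq|ba].
  rewrite leqNgt; apply/negP => ab; case: Amax => -[_ _ _ Np] _; apply: Np.
  have -> : p%:R^-1 = ratr q * u^-1 * p%:R ^+ (b - a.+1) :> K.
    have u0 : u != 0 by rewrite /u !mulf_neq0 ?signr_eq0 ?invr_eq0.
    have -> : (p%:R ^+ (b - a.+1) = p%:R ^+ b / p%:R ^+ a.+1 :> K)%R.
      by rewrite -expfB_cond // (negPf pC0).
    by rewrite uE exprS; field; rewrite u0 pC0 !expf_neq0.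
  by apply: AM; [apply: AM => //; case: uu|apply: AX; exact: Anat].
rewrite uE -expfB_cond; last by rewrite (negPf pC0).
by apply: AM; [case: uu|apply: AX; exact: Anat].
Qed.

(** Valuation rings are integrally closed: if [x^-1] is in [A], then [x] is [x ^ (n + 1)] times a
    power of [x^-1]. *)
Lemma maximal_avoiding_root x n : A (x ^+ n.+1) -> A x.
Proof.
move=> h; have [//|hx] := Aval x.
have [->|x0] := eqVneq x 0; first exact: (Anat 0).
have -> : x = x ^+ n.+1 * x^-1 ^+ n by rewrite exprS exprVn mulfK // expf_neq0.
by apply: AM => //; apply: AX.
Qed.

(** Divisibility is total in a valuation ring, so finitely many nonzero elements have one of largest
    absolute value. *)
Lemma maximal_avoiding_argmax (s : seq nat) (t : nat -> K) :
  (forall j, j \in s -> t j != 0) -> s != [::] ->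
  exists2 i, i \in s & forall j, j \in s -> A (t j / t i).
Proof.
elim: s => // a [|b s] IH t0 _.
  by exists a; rewrite ?mem_head // => j; rewrite inE => /eqP ->; rewrite divff ?t0 ?mem_head.
have [|//|i iS ih] := IH; first by move=> j js; apply: t0; rewrite inE js orbT.
have ti := t0 i; have ta := t0 a; rewrite mem_head in ta; rewrite inE iS orbT in ti.
have {}ti := ti isT; have {}ta := ta isT.
have [h|h] := Aval (t a / t i).
  exists i; first by rewrite inE iS orbT.
  by move=> j; rewrite inE => /predU1P[->//|]; exact: ih.
exists a; first exact: mem_head.
move=> j; rewrite inE => /predU1P[->//|js]; first by rewrite divff.
have -> : t j / t a = t j / t i * (t a / t i)^-1.
  by field; rewrite ti ta.
by apply: AM => //; exact: ih.
Qed.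


(** The maximal ideal of [A]; zero is listed apart because [0^-1 = 0] belongs to [A]. *)
Let nonunit x := A x /\ (x = 0 \/ ~ A x^-1).

Let nonunitD x y : nonunit x -> nonunit y -> nonunit (x + y).
Proof.
move=> hx hy; have := hx; have := hy => -[Ay [->|hy']]; first by rewrite addr0.
move=> -[Ax [->|hx']]; first by rewrite add0r.
split; first exact: maximal_avoidingD Amax _ _ Ax Ay.
have [] := maximal_avoiding_nonunitD Amax pC0 (Anat p) _ _ Ax Ay.
- by move=> [].
- by move=> [].
- by move=> h; right=> h'; apply: h; split=> //; exact: maximal_avoidingD Amax _ _ Ax Ay.
- by left.
Qed.

(** The value group of an algebraic extension is torsion over that of the rationals: in a vanishing
    sum of the [r_i * x ^ i], two terms of maximal size must agree up to a unit, and their quotient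
    is a power of [x] times a rational, up to inversion. *)
Lemma maximal_avoiding_torsion x : x != 0 ->
  (exists2 r : {poly rat}, r != 0 & root (map_poly ratr r) x) ->
  exists n q, [/\ q != 0, A (x ^+ n.+1 / ratr q) & A (x ^+ n.+1 / ratr q)^-1].
Proof.
move=> x0 [r r0 rx].
have ratr_eq0 (q : rat) : ((ratr q : K) == 0) = (q == 0) by rewrite fmorph_eq0.
pose t i : K := ratr r`_i * x ^+ i.
pose s := [seq i <- iota 0 (size r) | r`_i != 0].
have t0 j : j \in s -> t j != 0.
  by rewrite mem_filter => /andP[rj _]; rewrite mulf_neq0 ?ratr_eq0 ?expf_neq0.
have sn0 : s != [::].
  rewrite -has_filter; apply/hasP; exists (size r).-1.
    by rewrite mem_iota add0n leq0n /= ltn_predL size_poly_gt0.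
  by rewrite -lead_coefE lead_coef_eq0.
have sumt : \sum_(i <- s) t i = 0.
  rewrite big_filter big_mkcond /=; move: rx => /rootP.
  rewrite horner_coef size_map_poly -(big_mkord xpredT (fun i => (map_poly ratr r)`_i * x ^+ i)).
  rewrite /index_iota subn0 => h; rewrite -[RHS]h; apply: eq_bigr => i _.
  by rewrite coef_map /=; case: eqP => //= ->; rewrite rmorph0 mul0r.
have [i iS imax] := maximal_avoiding_argmax t0 sn0.
have us : uniq s by rewrite filter_uniq // iota_uniq.
(* Otherwise all terms but [t i], divided by [t i], lie in the maximal ideal, although they add up
   to -1. *)
have [j [js ji tj]] : exists j, [/\ j \in s, j != i & A (t j / t i)^-1].
  apply: contrapT => h.
  have : nonunit (\sum_(j <- rem i s) t j / t i).
    rewrite big_seq; apply: (big_ind nonunit) => //.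
      by split; [exact: (Anat 0)|left].
    move=> j; rewrite mem_rem_uniq // inE => /andP[ji js]; split; first exact: imax.
    by right=> h'; apply: h; exists j.
  rewrite -mulr_suml; move: sumt; rewrite (big_rem i) //= => /eqP.
  rewrite addrC addr_eq0 => /eqP ->; rewrite mulNr divff ?t0 // => -[_ []].
    by move=> /eqP; rewrite oppr_eq0 oner_eq0.
  by rewrite invrN1; apply; apply: AN.
have tA := imax _ js.
have rj : r`_j != 0 by move: js; rewrite mem_filter => /andP[].
have ri : r`_i != 0 by move: iS; rewrite mem_filter => /andP[].
have rjC : ratr r`_j != 0 :> K by rewrite ratr_eq0.
have riC : ratr r`_i != 0 :> K by rewrite ratr_eq0.
case: (ltngtP i j) ji => // lt _.
- exists (j - i).-1, (r`_i / r`_j); rewrite mulf_neq0 ?invr_eq0 //.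
  have -> : x ^+ (j - i).-1.+1 / ratr (r`_i / r`_j) = t j / t i.
    rewrite prednK ?subn_gt0 // expfB // fmorph_div /t; field.
    by rewrite rjC riC expf_neq0.
  by split.
- exists (i - j).-1, (r`_j / r`_i); rewrite mulf_neq0 ?invr_eq0 //.
  have -> : x ^+ (i - j).-1.+1 / ratr (r`_j / r`_i) = (t j / t i)^-1.
    rewrite prednK ?subn_gt0 // expfB // fmorph_div /t; field.
    by rewrite rjC riC !expf_neq0.
  by rewrite invrK; split.
Qed.

End PadicPlace.

Section PadicPlaceExists.
Variables (R : realType) (p : nat).
Hypothesis p_prime : prime p.
Variable K : numFieldType.
Hypothesis K_alg :
  forall x : K, exists2 r : {poly rat}, r != 0 & root (map_poly ratr r) x.

Let pK0 : p%:R != 0 :> K. Proof. by rewrite pnatr_eq0 -lt0n prime_gt0. Qed.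

Lemma padic_place_of : exists w : K -> R,
  absolute_value w /\ restr_rat w = padic_abs R p.
Proof.
have [A Amax] := maximal_avoiding_prime K p_prime.
have Anat := maximal_avoiding_nat Amax.
have AM := maximal_avoidingM Amax.
have AX := maximal_avoidingX Amax.
have AD := maximal_avoidingD Amax.
have Aval := maximal_avoiding_valuation Amax pK0 (Anat p).
have Arat := maximal_avoiding_rat R p_prime Amax.
have Aroot := maximal_avoiding_root p_prime Amax.
(* [w x] is the [n]-th root of [|q|_p] for any [n > 0] and rational [q] such
   that [x ^+ n / q] is a unit of the valuation ring [A]. *)
have frac_exprE (x a b : K) n m : x != 0 ->
    a ^+ m / b ^+ n = (x ^+ n / a)^-1 ^+ m * (x ^+ m / b) ^+ n.
  move=> x0; rewrite invf_div !exprMn !exprVn -!exprM [(m * _)%N]mulnC mulrA.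
  by rewrite mulfVK // expf_neq0.
pose W (x : K) (c : R) := 0 <= c /\ exists n q, [/\ q != 0, A (x ^+ n.+1 / ratr q),
  A (x ^+ n.+1 / ratr q)^-1 & c ^+ n.+1 = padic_abs R p q].
have ratr0 (q : rat) : q != 0 -> ratr q != 0 :> K by rewrite fmorph_eq0.
have Wex x : x != 0 -> exists c, W x c.
  move=> x0; have [n [q [q0 h1 h2]]] := maximal_avoiding_torsion p_prime Amax x0 (K_alg x).
  exists (padic_abs R p q `^ n.+1%:R^-1); split; first exact: powR_ge0.
  exists n, q; split=> //.
  by rewrite -powR_mulrn ?powR_ge0 // -powRrM mulVf ?pnatr_eq0 // powRr1 // padic_abs_ge0.
(* If [q] and [r] are the rationals of two such powers of [x], then [q ^ (m + 1) / r ^ (n + 1)] and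
   its inverse lie in [A]; by [maximal_avoiding_rat] both have p-adic absolute value at most 1. *)
have Wuniq x c d : x != 0 -> W x c -> W x d -> c = d.
  move=> x0 [c0 [n [q [q0 h1 h2 hc]]]] [d0 [m [r [r0 h3 h4 hd]]]].
  have le1 : padic_abs R p (q ^+ m.+1 / r ^+ n.+1) <= 1.
    apply/Arat; rewrite fmorph_div !rmorphXn /=.
    rewrite (frac_exprE _ _ _ _ _ x0).
    by apply: AM; apply: AX.
  have le2 : padic_abs R p (r ^+ n.+1 / q ^+ m.+1) <= 1.
    apply/Arat; rewrite fmorph_div !rmorphXn /=.
    rewrite (frac_exprE _ _ _ _ _ x0).
    by apply: AM; apply: AX.
  have e : padic_abs R p (q ^+ m.+1) = padic_abs R p (r ^+ n.+1).
    have q1 : q ^+ m.+1 != 0 by rewrite expf_neq0.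
    have r1 : r ^+ n.+1 != 0 by rewrite expf_neq0.
    apply/eqP; rewrite eq_le; apply/andP; split.
      rewrite -[X in padic_abs _ _ X <= _](mulfVK r1) padic_absM //.
      by rewrite ler_piMl // padic_abs_ge0.
    rewrite -[X in padic_abs _ _ X <= _](mulfVK q1) padic_absM //.
    by rewrite ler_piMl // padic_abs_ge0.
  move: e; rewrite !padic_absX // -hc -hd -!exprM mulnC => /eqP.
  by rewrite eqrXn2 //= => /eqP.
have WM x y c d : W x c -> W y d -> W (x * y) (c * d).
  move=> [c0 [n [q [q0 h1 h2 hc]]]] [d0 [m [r [r0 h3 h4 hd]]]].
  split; first exact: mulr_ge0.
  exists (n.+1 * m.+1).-1, (q ^+ m.+1 * r ^+ n.+1); rewrite prednK ?muln_gt0 //.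
  have e : (x * y) ^+ (n.+1 * m.+1) / ratr (q ^+ m.+1 * r ^+ n.+1) =
      (x ^+ n.+1 / ratr q) ^+ m.+1 * (y ^+ m.+1 / ratr r) ^+ n.+1.
    rewrite rmorphM !rmorphXn /=; move: (ratr q) (ratr r) => a b.
    rewrite !exprMn invfM -!exprM [(m.+1 * _)%N]mulnC.
    by rewrite !exprVn mulrACA.
  split; first by rewrite mulf_neq0 ?expf_neq0.
  - by rewrite e; apply: AM; apply: AX.
  - by rewrite e invfM -!exprVn; apply: AM; apply: AX.
  - by rewrite padic_absM // !padic_absX // -hc -hd exprMn -!exprM [(m.+1 * _)%N]mulnC.
(* [A] is the unit ball of the absolute value; the triangle inequality will come from its stability
   under addition. *)
have W_le1 x c : x != 0 -> W x c -> c <= 1 <-> A x.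
  move=> x0 [c0 [n [q [q0 h1 h2 hc]]]].
  rewrite -(@expr_le1 _ n.+1) // hc.
  split=> [/Arat h|Ax].
    by apply: (Aroot _ n); rewrite -(mulfVK (ratr0 _ q0) (x ^+ n.+1)); apply: AM.
  apply/Arat; have -> : ratr q = (x ^+ n.+1 / ratr q)^-1 * x ^+ n.+1.
    by rewrite [(_ / ratr q)^-1]invf_div mulfVK // expf_neq0.
  by apply: AM => //; apply: AX.
have Wrat q : q != 0 -> W (ratr q) (padic_abs R p q).
  move=> q0; split; first exact: padic_abs_ge0.
  exists 0%N, q; rewrite !expr1 divff ?ratr0 // invr1; split=> //; exact: (Anat 1%N).
have /choice[w wP] : forall x, exists c, if x == 0 then c = 0 else W x c.
  by move=> x; case: eqP => [_|/eqP/Wex //]; exists 0.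
have w0 : w 0 = 0 by have := wP 0; rewrite eqxx.
have wW x : x != 0 -> W x (w x) by move=> x0; have := wP x; rewrite (negPf x0).
have wM x y : w (x * y) = w x * w y.
  have [->|x0] := eqVneq x 0; first by rewrite mul0r w0 mul0r.
  have [->|y0] := eqVneq y 0; first by rewrite mulr0 w0 mulr0.
  have xy0 : x * y != 0 by rewrite mulf_neq0.
  by apply: (Wuniq _ _ _ xy0); [exact: wW|apply: WM; exact: wW].
have w_ge0 x : 0 <= w x.
  have [->|/wW[]//] := eqVneq x 0; by rewrite w0.
have w_eq0 x : w x = 0 -> x = 0.
  move=> wx; apply/eqP/negPn/negP => x0.
  have [_ [n [q [q0 _ _]]]] := wW _ x0.
  by rewrite wx expr0n /= => /esym/eqP; rewrite gt_eqF // padic_abs_gt0.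
exists w; split; first split=> // [x|x y].
- by split=> [/w_eq0//|->].
(* Once [x / y] is in [A], so is [x / y + 1]; hence [w (x + y) <= w y]. *)
- wlog : x y / A (x / y).
    move=> wl; have [|] := Aval (x / y); first exact: wl.
    by rewrite invf_div addrC [w x + _]addrC; apply: wl.
  have [->|y0] := eqVneq y 0; first by rewrite !addr0 w0 addr0.
  move=> Axy; have Axy1 : A (x / y + 1) by apply: AD => //; exact: (Anat 1%N).
  have -> : x + y = (x / y + 1) * y by field.
  rewrite wM; apply: (@le_trans _ _ (w y)); last by rewrite lerDr.
  have [->|h] := eqVneq (x / y + 1) 0; first by rewrite w0 mul0r.
  by rewrite ler_piMl //; apply/(W_le1 _ _ h) => //; exact: wW.
- apply/funext => q; rewrite /restr_rat.
  have [->|q0] := eqVneq q 0; first by rewrite rmorph0 w0 padic_abs0.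
  by apply: (Wuniq (ratr q)); [exact: ratr0|exact/wW/ratr0|exact: Wrat].
Qed.

End PadicPlaceExists.

Lemma padic_place (R : realType) (p : nat) : prime p -> exists w : algC -> R,
  absolute_value w /\ restr_rat w = padic_abs R p.
Proof.
move=> p_prime; apply: padic_place_of => // x.
have [r [_ /monic_neq0 r0] rP] := minCpolyP x.
by exists r => //; rewrite rP.
Qed.

Lemma ext_placeP (R : realType) (u : rat -> R) : places_rat u ->
  absolute_value (ext_place u) /\ restr_rat (ext_place u) = u.
Proof.
move=> pu; suff [w wP] : exists w : algC -> R, absolute_value w /\ restr_rat w = u.
  by have := getPex (ex_intro
    (fun w : algC -> R => absolute_value w /\ restr_rat w = u) w wP).
case: pu => [->|[p p_prime <-]]; [exact: archimedean_place|exact: padic_place].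
Qed.

(** * Absolute values and the product formula *)

Section AbsoluteValues.
Variables (R : realType) (K : fieldType) (w : K -> R).
Hypothesis wP : absolute_value w.

Lemma absv_ge0 x : 0 <= w x. Proof. by case: wP. Qed.
Lemma absv0 : w 0 = 0. Proof. by case: wP => _ h _ _; apply/h. Qed.
Lemma absv_eq0 x : (w x == 0) = (x == 0).
Proof. by case: wP => _ h _ _; apply/eqP/eqP => /h. Qed.
Lemma absv_gt0 x : (0 < w x) = (x != 0).
Proof. by rewrite lt_def absv_ge0 andbT absv_eq0. Qed.
Lemma absvM x y : w (x * y) = w x * w y. Proof. by case: wP => _ _ h _. Qed.
Lemma absvD x y : w (x + y) <= w x + w y. Proof. by case: wP. Qed.
Lemma absv1 : w 1 = 1.
Proof.
have h : w 1 != 0 by rewrite absv_eq0 oner_eq0.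
by apply: (mulfI h); rewrite -absvM !mulr1.
Qed.
Lemma absvX x n : w (x ^+ n) = w x ^+ n.
Proof. by elim: n => [|n IH]; rewrite ?absv1 // !exprS absvM IH. Qed.
Lemma absvN x : w (- x) = w x.
Proof.
rewrite -mulN1r absvM; have : w (-1) ^+ 2 = 1 ^+ 2 by rewrite -absvX sqrrN !expr1n absv1.
by move=> /eqP; rewrite eqrXn2 ?absv_ge0 // => /eqP ->; rewrite mul1r.
Qed.
Lemma absvV x : w x^-1 = (w x)^-1.
Proof.
have [->|x0] := eqVneq x 0; first by rewrite invr0 absv0 invr0.
have h : w x != 0 by rewrite absv_eq0.
by apply: (mulfI h); rewrite -absvM !divff // absv1.
Qed.
Lemma absv_sum (I : Type) (r : seq I) (P : pred I) (F : I -> K) :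
  w (\sum_(i <- r | P i) F i) <= \sum_(i <- r | P i) w (F i).
Proof.
apply: (big_ind2 (fun a b => w a <= b)) => //; first by rewrite absv0.
by move=> a b c d h h'; apply: le_trans (absvD _ _) _; apply: lerD.
Qed.
Lemma absv_prod (I : Type) (r : seq I) (P : pred I) (F : I -> K) :
  w (\prod_(i <- r | P i) F i) = \prod_(i <- r | P i) w (F i).
Proof. by apply: (big_morph _ absvM absv1). Qed.

Hypothesis w_nat : forall n : nat, w n%:R <= 1.

(* [w (x + y) ^ n <= (n + 1) (max (w x) (w y)) ^ n] for all [n] by the binomial
   formula. *)
Lemma nonarchD x y : w (x + y) <= Num.max (w x) (w y).
Proof.
set m := Num.max _ _; rewrite leNgt; apply/negP => mlt.
have m0 : 0 <= m by rewrite le_max absv_ge0.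
have bound n : w (x + y) ^+ n <= n.+1%:R * m ^+ n.
  rewrite -absvX exprDn; apply: le_trans (absv_sum _ _ _) _.
  rewrite [leRHS]mulrC mulr_natr -[X in _ *+ X]card_ord -sumr_const.
  apply: ler_sum => i _; rewrite -mulr_natr absvM absvM !absvX.
  apply: (@le_trans _ _ (w x ^+ (n - i) * w y ^+ i)).
    by rewrite ler_piMr // mulr_ge0 // exprn_ge0 // absv_ge0.
  have -> : m ^+ n = m ^+ (n - i) * m ^+ i by rewrite -exprD subnK // -ltnS.
  by apply: ler_pM; rewrite ?exprn_ge0 ?absv_ge0 // lerXn2r ?nnegrE ?absv_ge0 // le_max lexx ?orbT.
have s0 : 0 < w (x + y) by apply: le_lt_trans mlt.
have [m00|m00] := eqVneq m 0.
  by have := bound 1%N; rewrite m00 expr0n mulr0 expr1 leNgt s0.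
have mp : 0 < m by rewrite lt_def m00.
set t := w (x + y) / m; have t1 : 1 < t by rewrite /t ltr_pdivlMr // mul1r.
have tb n : t ^+ n <= n.+1%:R.
  by rewrite /t exprMn exprVn ler_pdivrMr ?exprn_gt0.
pose e := t - 1; have e0 : 0 < e by rewrite subr_gt0.
have bern n : 1 + n%:R * e <= t ^+ n.
  elim: n => [|n IH]; first by rewrite mul0r addr0 expr0.
  rewrite exprSr; have te : t = 1 + e by rewrite /e; ring.
  rewrite [X in _ <= _ * X]te.
  rewrite -natr1; apply: (@le_trans _ _ ((1 + n%:R * e) * (1 + e))).
    have : 0 <= n%:R * e * e by rewrite !mulr_ge0 // ltW.
    have -> : (1 + n%:R * e) * (1 + e) = 1 + (n%:R + 1) * e + n%:R * e * e by ring.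
    by lra.
  by rewrite ler_wpM2r // addr_ge0 // ltW.
(* Bernoulli's bound is only linear; squared, it gives [t ^ (2 n) >= (1 + n e) ^ 2 > 1 + 4 n] for
   this [n], against the bound [2 n + 1]. *)
have [n hn] : exists n : nat, 4 < n%:R * e ^+ 2.
  exists (Num.truncn (4 / e ^+ 2)).+1; rewrite -ltr_pdivrMr ?exprn_gt0 //.
  exact: truncnS_gt.
have := tb (n + n)%N; rewrite exprD leNgt => /negP; apply.
apply: (@lt_le_trans _ _ ((1 + n%:R * e) * (1 + n%:R * e))); last first.
  by apply: ler_pM => //; rewrite addr_ge0 // mulr_ge0 // ltW.
rewrite -natr1 natrD; have n0 : 0 <= n%:R :> R by [].
move: (n%:R : R) n0 hn => a a0; rewrite expr2 => hn.
have h4 : 4 * a <= a * (a * (e * e)) by rewrite mulrC ler_wpM2l // ltW.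
have h5 : 0 <= a * e by rewrite mulr_ge0 // ltW.
have a1 : 0 < a.
  by rewrite lt_def a0 andbT; apply/eqP => a00; move: hn; rewrite a00 mul0r; lra.
have -> : (1 + a * e) * (1 + a * e) = 1 + 2 * (a * e) + a * (a * (e * e)) by ring.
lra.
Qed.

Lemma nonarch_sum (I : eqType) (r : seq I) (P : pred I) (F : I -> K) c : 0 <= c ->
  (forall i, i \in r -> P i -> w (F i) <= c) -> w (\sum_(i <- r | P i) F i) <= c.
Proof.
move=> c0 h; rewrite big_seq_cond; apply: (big_ind (fun a => w a <= c)).
- by rewrite absv0.
- by move=> a b ha hb; apply: le_trans (nonarchD _ _) _; rewrite ge_max ha.
- by move=> i /andP[ir Pi]; apply: h.
Qed.

(** If [w x > 1], the leading term of [f.[x] = 0] would outweigh all the others in the ultrametric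
    inequality. *)
Lemma integral_absv_le1 (f : {poly K}) x : f \is monic -> root f x ->
  (forall i, w f`_i <= 1) -> w x <= 1.
Proof.
move=> fmon /rootP fx fle; rewrite leNgt; apply/negP => wx.
have wx0 : 0 < w x by apply: lt_trans wx.
have [n nE] : exists n, size f = n.+1.
  by exists (size f).-1; rewrite prednK // size_poly_gt0 monic_neq0.
move: fx; rewrite horner_coef nE big_ord_recr /=.
move: fmon; rewrite monicE lead_coefE nE => /eqP ->; rewrite mul1r => /eqP.
rewrite addrC addr_eq0 => /eqP /(congr1 w); rewrite absvN absvX => e.
case: n nE e => [|n] nE e.
  by move/eqP: e; rewrite big_ord0 absv0 expr0 oner_eq0.
have : w x ^+ n.+1 <= w x ^+ n.
  rewrite e; apply: nonarch_sum => [|i _ _]; first by rewrite exprn_ge0 ?absv_ge0.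
  rewrite absvM absvX -[leRHS]mul1r; apply: ler_pM => //; rewrite ?exprn_ge0 ?absv_ge0 //.
  by rewrite ler_eXn2l // -ltnS.
by rewrite leNgt ltr_eXn2l // ltnSn.
Qed.

End AbsoluteValues.

(* The places of [rat] are indexed by [0] (archimedean) and the primes. *)
Definition is_place (n : nat) := (n == 0%N) || prime n.

Definition rat_place (R : realType) (n : nat) : rat -> R :=
  if n == 0%N then fun q => `|ratr q| else padic_abs R n.
Arguments rat_place R n : clear implicits.

Definition alg_place (R : realType) (n : nat) : algC -> R :=
  ext_place (rat_place R n).
Arguments alg_place R n : clear implicits.

Lemma ln_prod (R : realType) (I : Type) (r : seq I) (P : pred I) (F : I -> R) :
  (forall i, P i -> 0 < F i) ->
  ln (\prod_(i <- r | P i) F i) = \sum_(i <- r | P i) ln (F i).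
Proof.
move=> F0; suff [] : 0 < \prod_(i <- r | P i) F i /\
    ln (\prod_(i <- r | P i) F i) = \sum_(i <- r | P i) ln (F i) by [].
apply: (big_ind2 (fun a b => 0 < a /\ ln a = b)); first by rewrite ln1.
  by move=> a b c d [a0 <-] [c0 <-]; rewrite mulr_gt0 // lnM.
by move=> i Pi; split=> //; exact: F0.
Qed.

(** * The chosen extensions of the rational places, and the product formula over the rationals *)

Section Places.
Variable R : realType.
Local Notation w := (alg_place R).

Lemma places_rat_rat_place n : is_place n -> places_rat (rat_place R n).
Proof.
by rewrite /is_place /rat_place; case: eqP => [_ _|_ /= pn]; [left|right; exists n].
Qed.

Lemma places_ratP (u : rat -> R) : places_rat u <->
  exists2 n, is_place n & u = rat_place R n.
Proof.
split=> [[->|[p pp <-]]|[n pn ->]]; last exact: places_rat_rat_place.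
  by exists 0%N.
exists p; first by rewrite /is_place pp orbT.
by rewrite /rat_place; case: eqP => // p0; move: pp; rewrite /= p0.
Qed.

Lemma alg_place_absv n : is_place n -> absolute_value (w n).
Proof. by move=> /places_rat_rat_place/ext_placeP[]. Qed.

Lemma restr_alg_place n : is_place n -> restr_rat (w n) = rat_place R n.
Proof. by move=> /places_rat_rat_place/ext_placeP[]. Qed.

Lemma alg_place_rat n q : is_place n -> w n (ratr q) = rat_place R n q.
Proof. by move=> /restr_alg_place <-. Qed.

Lemma alg_place_nat n k : prime n -> w n k%:R <= 1.
Proof.
move=> pn; have pl : is_place n by rewrite /is_place pn orbT.
rewrite -(ratr_nat _ k) alg_place_rat // /rat_place.
case: eqP => [n0|_]; first by move: pn; rewrite n0.
exact: (padic_abs_int_le1 R pn k).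
Qed.

Lemma rat_place_inj m n : is_place m -> is_place n ->
  rat_place R m = rat_place R n -> m = n.
Proof.
have self p : prime p -> padic_abs R p p%:R = p%:R^-1.
  move=> pp; have := @padic_abs_frac R p pp p 1; rewrite divr1 => -> //.
    by rewrite logn1 expr0 div1r /= logn_prime // eqxx expr1.
  by rewrite -lt0n prime_gt0.
have lt1 p : prime p -> p%:R^-1 < 1 :> R.
  by move=> pp; rewrite invf_lt1 ?ltr0n ?prime_gt0 // ltr1n prime_gt1.
have wlog0 p : prime p -> rat_place R 0 = rat_place R p -> False.
  move=> pp /(congr1 (fun u => u p%:R)); rewrite /rat_place /=.
  case: eqP => [p0|_]; first by move: pp; rewrite p0.
  rewrite self // ratr_nat normr_nat => e.
  by have := lt1 _ pp; rewrite -e ltNge ler1n prime_gt0.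
rewrite /is_place => /orP[/eqP ->|pm] /orP[/eqP ->|pn] //.
- by move=> /(wlog0 _ pn).
- by move=> /esym/(wlog0 _ pm).
- move=> /(congr1 (fun u => u m%:R)); rewrite /rat_place.
  case: eqP => [m0|_]; first by move: pm; rewrite m0.
  case: eqP => [n0|_]; first by move: pn; rewrite n0.
  rewrite self // => e; apply/eqP/negPn/negP => mn.
  have := lt1 _ pm; rewrite e padic_abs_coprime ?prime_gt0 ?ltxx //.
  by rewrite prime_coprime // dvdn_prime2 // eq_sym.
Qed.

(** For [q = a / b] up to sign, factoring [a] and [b] into primes shows that the finite places add
    up to [ln b - ln a]. The formula holds as soon as [M] exceeds [a] and [b]. *)
Lemma rat_place_product_formula (q : rat) : q != 0 ->
  \forall M \near \oo, \sum_(n < M | is_place n) ln (rat_place R n q) = 0.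
Proof.
move=> q0.
have nat_formula (a : nat) : (0 < a)%N -> forall M, (a < M)%N ->
    \sum_(n < M | prime n) (logn n a)%:R * ln n%:R = ln a%:R :> R.
  move=> a0 M aM; have aE : a = (\prod_(n < M) n ^ logn n a)%N.
    case: M aM => // M aM; rewrite -[LHS](partnT a0) (widen_partn _ (aM : (a <= M)%N)).
    by rewrite big_mkord; apply: eq_bigl.
  rewrite [in RHS]aE natr_prod ln_prod; last first.
    move=> n _; rewrite ltr0n expn_gt0; case: (posnP n) => //= ->.
    by rewrite /logn.
  rewrite big_mkcond; apply: eq_bigr => n _; case: ifP => [pn|npn].
    by rewrite natrX lnXn ?ltr0n ?prime_gt0 // mulr_natl.
  by rewrite /logn npn expn0 ln1.
set a := `|numq q|%N; set b := `|denq q|%N.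
have a0 : (0 < a)%N by rewrite absz_gt0 numq_eq0.
have b0 : (0 < b)%N by rewrite absz_gt0 denq_neq0.
near=> M; have aM : (a < M)%N by near: M; apply: nbhs_infty_gt.
have bM : (b < M)%N by near: M; apply: nbhs_infty_gt.
have M0 : (0 < M)%N by apply: leq_ltn_trans aM.
rewrite (bigD1 (Ordinal M0)) //=.
have -> : \sum_(i < M | is_place i && (i != Ordinal M0)) ln (rat_place R i q) =
    \sum_(i < M | prime i) ((logn i b)%:R * ln i%:R - (logn i a)%:R * ln i%:R).
  apply: eq_big => [i|i /andP[]].
    rewrite /is_place -val_eqE /=; case: eqP => //= [->|]//=; by rewrite andbT.
  rewrite /is_place -val_eqE /= /rat_place; case: eqP => //= i0 pi _.
  have ip : 0 < i%:R :> R by rewrite ltr0n prime_gt0.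
  rewrite /padic_abs (negPf q0) ln_div ?posrE ?exprn_gt0 // !lnXn //.
  by rewrite !mulr_natl.
rewrite sumrB !nat_formula // /rat_place /=.
have qE : `|ratr q| = a%:R / b%:R :> R.
  rewrite -[q in LHS]divq_num_den fmorph_div /= !ratr_int normf_div.
  by rewrite /a /b !natr_absz !intr_norm.
rewrite qE ln_div ?posrE ?ltr0n //; ring.
Unshelve. all: by end_near. Qed.

(** At a prime beyond all denominators of the minimal polynomial, its coefficients have absolute
    value at most 1. *)
Lemma alg_place_integral (x : algC) :
  \forall n \near \oo, is_place n -> w n x <= 1.
Proof.
have [r [_ rmon] rP] := minCpolyP x.
pose b := \max_(i < size r) `|denq r`_i|%N.
near=> n; have bn : (b < n)%N by near: n; apply: nbhs_infty_gt.
rewrite /is_place; case: eqP => [n0|_ /= pn]; first by move: bn; rewrite n0.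
have pl : is_place n by rewrite /is_place pn orbT.
apply: (integral_absv_le1 (alg_place_absv pl) _ (f := map_poly ratr r)).
- by move=> k; exact: alg_place_nat.
- by rewrite map_monic.
- by rewrite rP.
- move=> i; rewrite coef_map /= alg_place_rat // /rat_place.
  case: eqP => [n0|_]; first by move: bn; rewrite n0.
  have [->|ri] := eqVneq r`_i 0; first by rewrite padic_abs0.
  have ir : (i < size r)%N.
    by rewrite ltnNge; apply: contra ri => /leq_sizeP/(_ i (leqnn _)) ->.
  rewrite /padic_abs (negPf ri) -[X in X / _](_ : 1 = _); last first.
    rewrite logn_coprime // prime_coprime //; apply/negP => /dvdn_leq.
    rewrite absz_gt0 denq_neq0 => /(_ isT); rewrite leqNgt => /negP; apply.
    by apply: leq_ltn_trans bn; apply: (leq_bigmax (Ordinal ir)).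
  rewrite div1r invf_le1 ?exprn_gt0 ?ltr0n ?prime_gt0 //.
  by rewrite exprn_ege1 // ler1n prime_gt0.
Unshelve. all: by end_near. Qed.

Lemma alg_place_eq1 (x : algC) : x != 0 ->
  \forall n \near \oo, is_place n -> w n x = 1.
Proof.
move=> x0; near=> n => pl; apply/eqP; rewrite eq_le; apply/andP; split.
  by move: pl; near: n; exact: alg_place_integral.
have wP := alg_place_absv pl.
rewrite -[x]invrK absvV // invf_ge1 ?absv_gt0 ?invr_eq0 //.
by move: pl; near: n; exact: alg_place_integral.
Unshelve. all: by end_near. Qed.

End Places.

(** * Number fields and their embeddings *)

Lemma common_rat_poly (s : seq algC) : exists q : {poly rat}, q != 0 /\
  forall x, x \in s -> root (map_poly ratr q) x.
Proof.
elim: s => [|a s [q [q0 qs]]]; first by exists 1; rewrite oner_eq0.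
have [p [_ pmon] pP] := minCpolyP a.
exists (p * q); split; first by rewrite mulf_neq0 // monic_neq0.
move=> x; rewrite inE rmorphM rootM => /predU1P[->|/qs ->]; last by rewrite orbT.
by rewrite pP dvdpp.
Qed.

(** One rational polynomial vanishes on [s]; adjoining all its roots, and not only [s], makes the
    field normal. *)
Lemma normal_num_field_exists (s : seq algC) :
  exists (L : splittingFieldType rat) (i : {rmorphism L -> algC}),
    forall x, x \in s -> exists y, i y = x.
Proof.
have [q [q0 qs]] := common_rat_poly s.
have [r Dr] := closed_field_poly_normal (map_poly ratr q : {poly algC}).
have lc0 : lead_coef (map_poly ratr q : {poly algC}) != 0.
  by rewrite lead_coef_eq0 map_poly_eq0.
have [Qr [QrC [rr Drr genQr]]] := num_field_exists r.
pose pr := map_poly (in_alg Qr) q.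
have prC : map_poly QrC pr = map_poly ratr q.
  rewrite -map_poly_comp; apply: eq_map_poly => a /=.
  by rewrite alg_num_field fmorph_rat.
have ax : SplittingField.axiom Qr.
  exists pr; first by apply/polyOverP=> k; rewrite coef_map memvZ ?memv_line.
  exists rr => //; rewrite -(eqp_map QrC) prC Dr.
  rewrite rmorph_prod /= -Drr big_map (eqp_trans (eqp_scale _ lc0)) //.
  under [X in _ %= X]eq_bigr do rewrite map_polyXsubC.
  exact: eqpxx.
pose QrMixin := FieldExt_isSplittingField.Build _ Qr ax.
pose L : splittingFieldType rat := HB.pack (FieldExt.sort Qr) QrMixin.
exists L, QrC => x xs.
have : root (map_poly ratr q) x by apply: qs.
rewrite Dr rootZ // root_prod_XsubC -Drr => /mapP[y _ ->]; by exists y.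
Qed.

(** Preimages under the injective [i] are unique, so a choice of them respects every operation that
    [f] and [i] respect. *)
Lemma num_field_embed (K L : fieldExtType rat) (f : {rmorphism K -> algC})
    (i : {rmorphism L -> algC}) :
  (forall x, exists y, i y = f x) ->
  exists j : {lrmorphism K -> L}, forall x, f x = i (j x).
Proof.
move=> /choice[j jP].
pose rwM := (jP, rmorphZ_num, rmorph1, rmorphB, rmorphM).
have ja : zmod_morphism j by move=> x y; apply: (fmorph_inj i); rewrite !rwM.
have jm : monoid_morphism j.
  by split; try move=> x y; apply: (fmorph_inj i); rewrite !rwM /= ?rwM.
have jl : scalable j by move=> a x; apply: (fmorph_inj i); rewrite !rwM.
pose jaM := GRing.isZmodMorphism.Build _ _ j ja.
pose jmM := GRing.isMonoidMorphism.Build _ _ j jm.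
pose jlM := GRing.isScalable.Build _ _ _ _ j jl.
pose jLRM : {lrmorphism K -> L} := HB.pack j jaM jmM jlM.
by exists jLRM => x /=; rewrite jP.
Qed.

Lemma num_field_embed_basis (K L : fieldExtType rat) (f : {rmorphism K -> algC})
    (i : {rmorphism L -> algC}) :
  (forall x, x \in vbasis {:K} -> exists y, i y = f x) ->
  exists j : {lrmorphism K -> L}, forall x, f x = i (j x).
Proof.
move=> h; apply: num_field_embed => x.
rewrite (coord_vbasis (memvf x)).
elim/big_ind: _ => [|a b [y hy] [z hz]|k _].
- by exists 0; rewrite !rmorph0.
- by exists (y + z); rewrite !rmorphD hy hz.
- have [|y hy] := h (vbasis {:K})`_k; first by rewrite mem_nth // size_tuple.
  by exists (coord (vbasis {:K}) k x *: y); rewrite !rmorphZ_num hy.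
Qed.

Section GaloisEmbeddings.
Variables (K : fieldExtType rat) (L : splittingFieldType rat).
Variables (i : {rmorphism L -> algC}) (j : {lrmorphism K -> L}).

Let lj := linfun j.

Let image_field : {E : {subfield L} | E = limg lj :> {vspace L}}.
Proof.
have memE y : reflect (exists x, y = j x) (y \in limg lj).
  apply: (iffP memv_imgP) => [[x _ ->]|[x ->]]; by exists x; rewrite ?lfunE ?memvf.
have algE : is_aspace (limg lj).
  rewrite /is_aspace has_algid1; last by apply/memE; exists 1; rewrite rmorph1.
  apply/prodvP=> _ _ /memE[x ->] /memE[y ->].
  by apply/memE; exists (x * y); rewrite rmorphM.
by exists (ASpace algE).
Qed.

Let ker_lj : lker lj == 0%VS.
Proof. by apply/lker0P=> x y; rewrite !lfunE; apply: fmorph_inj. Qed.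

(** [s x] is a root of the rational minimal polynomial of [j x], which splits in the normal field
    [L]. *)
Lemma embedding_in_normal_field (s : {rmorphism K -> algC}) x : exists y, i y = s x.
Proof.
have [rs /eqP Drs] := splitting_field_normal 1%AS (j x).
have /polyOver1P[q qE] := minPolyOver 1%AS (j x).
have qx : root (map_poly (in_alg K) q) x.
  rewrite -(fmorph_root j) -map_poly_comp.
  have -> : map_poly (j \o in_alg K) q = minPoly 1 (j x).
    by rewrite qE; apply: eq_map_poly => a /=; rewrite rmorph_alg.
  exact: root_minPoly.
have : root (map_poly i (minPoly 1 (j x))) (s x).
  have -> : map_poly i (minPoly 1 (j x)) = map_poly s (map_poly (in_alg K) q).
    rewrite qE -!map_poly_comp; apply: eq_map_poly => a /=.
    by rewrite !alg_num_field !fmorph_rat.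
  by rewrite fmorph_root.
rewrite Drs rmorph_prod /=.
under eq_bigr do rewrite map_polyXsubC.
rewrite -(big_map i xpredT (fun z => 'X - z%:P)) root_prod_XsubC => /mapP[y _ ->].
by exists y.
Qed.

(** Factor [s] as [i \o j']; the map [j x] to [j' x] is a homomorphism on the subfield [j(K)], and
    normality extends it to an automorphism of [L]. *)
Lemma embedding_galois (s : {rmorphism K -> algC}) :
  exists g : gal_of {:L}, forall x, s x = i (g (j x)).
Proof.
have [j' j'E] := num_field_embed (embedding_in_normal_field s).
have [E EE] := image_field.
pose f := (linfun j' \o lj^-1)%VF.
have fE x : f (j x) = j' x.
  have -> : j x = lj x by rewrite lfunE.
  by rewrite /f comp_lfunE lker0_lfunK // lfunE.
have memE y : y \in E -> exists x, y = j x.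
  by rewrite EE => /memv_imgP[x _ ->]; exists x; rewrite lfunE.
have homf : kHom 1 E f.
  apply/kHomP_tmp; split=> [_ /vlineP[a ->]|_ _ /memE[x ->] /memE[y ->]].
    by rewrite -(rmorph_alg j) fE !rmorph_alg.
  by rewrite -rmorphM !fE rmorphM.
have [|g _ gE] := kHom_to_gal _ (normalFieldf 1) homf.
  by rewrite sub1v subvf.
exists g => x; rewrite j'E -gE ?fE //.
by rewrite EE; apply/memv_imgP; exists x; rewrite ?memvf // lfunE.
Qed.

Lemma galois_num_field : galois 1 {:L}.
Proof.
rewrite /galois sub1v normalFieldf andbT /=; apply/separableP => y _.
apply: pcharf0_separable => p.
by rewrite (fmorph_pchar (in_alg L)) pchar_num.
Qed.

(** The tower law for [L] over [j(K)] over the rationals; the set is the Galois group of [L] over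
    [j(K)]. *)
Lemma galois_fiber_card :
  (\dim {:K} * #|[set g : gal_of {:L} | `[< forall x, g (j x) = j x >]]%SET|
     = #|{: gal_of {:L}}|)%N.
Proof.
have [E EE] := image_field.
have -> : [set g : gal_of {:L} | `[< forall x, g (j x) = j x >]]%SET = 'Gal({:L} / E)%g.
  apply/setP => g; rewrite inE gal_kHom ?subvf //.
  apply/asboolP/kAHomP => [h y|h x].
    by rewrite EE => /memv_imgP[x _ ->]; rewrite [lj x]lfunE; exact: h.
  by apply: h; rewrite EE; apply/memv_imgP; exists x; rewrite ?memvf // lfunE.
have galE : galois E {:L} by apply: (galoisS _ galois_num_field); rewrite sub1v subvf.
have -> : \dim {:K} = \dim E.
  rewrite EE limg_dim_eq //; by move: ker_lj => /eqP ->; rewrite capv0.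
rewrite -galois_dim // mulnC -dim_sup_field ?subvf //.
have -> : #|{: gal_of {:L}}| = #|'Gal({:L} / 1)%g|.
  apply/esym/eq_card => g; rewrite gal_kHom ?sub1v //.
  by rewrite k1AHom.
by rewrite -(galois_dim galois_num_field) dimv1 divn1.
Qed.

Lemma gal_norm_rat (z : L) : exists q : rat, \prod_(g : gal_of {:L}) g z = ratr q.
Proof.
have : galNorm 1 {:L} z \in 1%VS by rewrite mem_galNorm ?memvf // galois_num_field.
move=> /vlineP[q qE]; exists q; rewrite -alg_num_field -qE; apply: eq_bigl => g.
by rewrite gal_kHom ?sub1v // k1AHom.
Qed.

End GaloisEmbeddings.

(** * The height as a Galois average *)

Section HeightFormula.
Variables (R : realType) (L : splittingFieldType rat) (i : {rmorphism L -> algC}).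
Local Notation w := (alg_place R).

(** The share of the rational place [n] in the height, multiplied by the order of the Galois group:
    moving one fixed extension of the place by all [g] stands for summing over the places above [n]
    with their local degrees. *)
Definition place_sum N (y : 'rV[L]_N.+1) (n : nat) : R :=
  \sum_(g : gal_of {:L}) ln (\big[Num.max/0]_k w n (i (g (y 0 k)))).

Lemma gal_eq0 (g : gal_of {:L}) (z : L) : (i (g z) == 0) = (z == 0).
Proof. by rewrite fmorph_eq0 -[X in _ == X](rmorph0 (gal_repr g)) (inj_eq (fmorph_inj _)). Qed.

Variables (K : fieldExtType rat) (j : {lrmorphism K -> L}).

(** By [embedding_galois], [sigma g] runs through all embeddings of [K], with repetitions; [Phi n g]
    is the absolute value of [K] above [n] that it induces. *)
Let sigma (g : gal_of {:L}) (z : K) : algC := i (g (j z)).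
Let Phi n g (z : K) : R := w n (sigma g z).

Lemma conjugate_place n g : is_place n ->
  absolute_value (Phi n g) /\ restr_rat (Phi n g) = rat_place R n.
Proof.
move=> pn; have wP := alg_place_absv R pn; split.
  split=> [x|x|x y|x y]; rewrite /Phi /sigma.
  - exact: absv_ge0.
  - split=> [/eqP|->]; last by rewrite !rmorph0 absv0.
    by rewrite absv_eq0 // gal_eq0 fmorph_eq0 => /eqP.
  - by rewrite !rmorphM absvM.
  - by rewrite !rmorphD absvD.
apply/funext => q; rewrite /restr_rat /Phi /sigma !fmorph_rat.
exact: alg_place_rat.
Qed.

Let m := #|[set g : gal_of {:L} | `[< forall x, g (j x) = j x >]]%SET|.

(** Two automorphisms induce the same embedding exactly when they lie in the same right coset of the
    group fixing [j(K)]; products act left factor first. *)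
Lemma sigma_fiber_card g0 : #|[set g | sigma g == sigma g0]%SET| = m.
Proof.
rewrite -[RHS](card_rcoset _ g0); apply: eq_card => g.
rewrite mem_rcoset !inE; apply/eqP/asboolP => [e x|e].
  have /(fmorph_inj i) h : sigma g x = sigma g0 x by rewrite e.
  by rewrite galM ?memvf // h -galM ?memvf // mulgV gal_id.
apply/funext => x; rewrite /sigma; congr (i _).
by rewrite -[in RHS](e x) -galM ?memvf // mulgKV.
Qed.

Let embeddings (v : K -> R) : set (K -> algC) :=
  [set s : K -> algC | range (fun f : {rmorphism K -> algC} =>
     (f : K -> algC)) s /\ ext_place (restr_rat v) \o s = v].

Lemma embeddings_range v s : embeddings v s -> exists g, s = sigma g.
Proof.
move=> [[f _ <-] _]; have [g gE] := embedding_galois i j f.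
by exists g; apply/funext => x; rewrite gE.
Qed.

Lemma sigma_embeddings v g :
  embeddings v (sigma g) <-> ext_place (restr_rat v) \o sigma g = v.
Proof.
split=> [[]//|h]; split=> //.
by exists (i \o (gal_repr g \o j) : {rmorphism K -> algC}).
Qed.

(** Count the pairs of an embedding [s] inducing [v] and a [g] with [sigma g = s]: each [s] has [m]
    partners, each [g] at most one. *)
Lemma local_degree_card (v : K -> R) :
  (m * local_degree v = #|[set g | `[< ext_place (restr_rat v) \o sigma g = v >]]%SET|)%N.
Proof.
have fin : finite_set (embeddings v).
  apply: (@sub_finite_set _ _ (sigma @` setT)); last exact/finite_image/finite_finset.
  by move=> s /embeddings_range[g ->]; exists g.
rewrite /local_degree -/(embeddings v).
set E := fset_set _.
have EP s : (s \in E) = `[< embeddings v s >] by rewrite in_fset_set // /in_mem /= .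
rewrite -sum1_size big_distrr /=.
transitivity (\sum_(s <- E) \sum_(g : gal_of {:L}) (sigma g == s : nat))%N.
  rewrite big_seq [RHS]big_seq; apply: eq_bigr => s.
  rewrite EP => /asboolP/embeddings_range[g0 ->].
  rewrite muln1 -(sigma_fiber_card g0) -sum1_card big_mkcond /=.
  by apply: eq_bigr => g _; rewrite inE; case: eqP.
rewrite exchange_big /= -sum1_card [RHS]big_mkcond; apply: eq_bigr => g _.
rewrite inE.
transitivity (sigma g \in E : nat).
  rewrite -(count_uniq_mem _ (fset_uniq E)) -sum1_count [RHS]big_mkcond /=.
  by apply: eq_bigr => s _; rewrite eq_sym; case: eqP.
rewrite EP (_ : `[< embeddings v (sigma g) >] = `[< ext_place (restr_rat v) \o sigma g = v >]).
  by case: asboolP.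
by apply/asboolP/asboolP => /sigma_embeddings.
Qed.

(** The group order is [\dim {:K} * m]; the first factor cancels the normalisation and the second
    turns local degrees into numbers of automorphisms. Each pair of a rational place [n] and a [g]
    is then counted for the single absolute value [Phi n g]. *)
Lemma number_field_heightE N (x : 'rV[K]_N.+1) : x != 0 ->
  \forall M \near \oo, #|{: gal_of {:L}}|%:R * number_field_height R x =
    \sum_(n < M | is_place n) place_sum (map_mx j x) n.
Proof.
move=> x0.
pose F (v : K -> R) : R := ln (\big[Num.max/0]_k v (x 0 k)).
have m0 : (0 < m)%N.
  by apply/card_gt0P; exists 1%g; rewrite inE; apply/asboolP => z; rewrite gal_id.
(* only finitely many of the absolute values [Phi n g] are nontrivial on [x] *)
have trivial_near : \forall n \near \oo, is_place n -> forall g, F (Phi n g) = 0.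
  have h1 : \forall n \near \oo, forall gk : gal_of {:L} * 'I_N.+1,
      is_place n -> Phi n gk.1 (x 0 gk.2) <= 1.
    by apply: filter_forall => -[g k]; exact: alg_place_integral.
  have /rV0Pn[k xk] := x0.
  have h2 : \forall n \near \oo, forall g, is_place n -> Phi n g (x 0 k) = 1.
    apply: filter_forall => g; apply: alg_place_eq1.
    by rewrite gal_eq0 fmorph_eq0.
  near=> n => pn g; rewrite /F.
  suff -> : \big[Num.max/0]_k Phi n g (x 0 k) = 1 by rewrite ln1.
  apply/eqP; rewrite eq_le; apply/andP; split.
    apply/bigmax_leP; split=> // l _.
    by have := near h1 n _ (g, l) pn; apply.
  rewrite -(near h2 n _ g pn) //.
  exact: (le_bigmax _ (fun l => Phi n g (x 0 l)) k).
have [M0 _ trivial_ge] := trivial_near.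
near=> M; have M0M : (M0 <= M)%N by near: M; exact: nbhs_infty_ge.
(* Different pairs may induce the same absolute value, so duplicates are removed before summing over
   places. *)
pose V := undup [seq Phi n g | n <- [seq n <- iota 0 M | is_place n], g <- enum {: gal_of {:L}}].
have VP v : v \in V -> exists n g, [/\ (n < M)%N, is_place n & v = Phi n g].
  rewrite mem_undup => /allpairsP[[n g] /= [+ _ ->]].
  by rewrite mem_filter mem_iota add0n => /andP[pn nM]; exists n, g.
have PhiV n g : (n < M)%N -> is_place n -> Phi n g \in V.
  move=> nM pn; rewrite mem_undup; apply/allpairsP; exists (n, g).
  by rewrite mem_filter mem_iota add0n pn mem_enum.
rewrite /number_field_height (@fsbigE _ _ _ _ _ V) ?undup_uniq //; last 2 first.
- move=> v /= /VP[n [g [_ pn ->]]]; have [h1 h2] := conjugate_place g pn.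
  by split=> //; rewrite h2; exact: places_rat_rat_place.
(* A place outside [V] contributes nothing: its local degree is 0, or it is some [Phi n g] with
   [n >= M0], for which [F] vanishes. *)
- move=> v [vabs vplace] vV; have [n pn vn] := (places_ratP _).1 vplace.
  have [->|ld0] := eqVneq (local_degree v) 0%N; first by rewrite mul0r.
  have : (0 < m * local_degree v)%N by rewrite muln_gt0 m0 lt0n.
  rewrite local_degree_card => /card_gt0P[g]; rewrite inE => /asboolP.
  rewrite vn => vE; have {}vE : v = Phi n g by rewrite -vE.
  have nM : (M0 <= n)%N.
    by rewrite leqNgt; apply: contra vV => nM0; rewrite vE PhiV // (leq_trans nM0).
  by have := trivial_ge n nM pn g; rewrite -vE /F => ->; rewrite mulr0.
rewrite -(galois_fiber_card j) -/m natrM.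
have dK0 : (\dim {:K})%:R != 0 :> R by rewrite pnatr_eq0 -lt0n adim_gt0.
rewrite mulrACA mulfV // mul1r.
rewrite mulr_sumr.
transitivity (\sum_(v <- V) \sum_(g : gal_of {:L})
    (`[< ext_place (restr_rat v) \o sigma g = v >] : nat)%:R * F v).
  rewrite big_seq_cond [RHS]big_seq; apply: eq_big => [v|v /andP[vV _]].
    apply: andb_idr => /VP[n [g [_ pn ->]]]; rewrite inE.
    have [h1 h2] := conjugate_place g pn.
    by split=> //; rewrite h2; exact: places_rat_rat_place.
  rewrite mulrA -natrM local_degree_card -sum1_card natr_sum big_mkcond mulr_suml.
  by apply: eq_bigr => g _; rewrite inE; case: ifP => _; rewrite ?mul1r ?mul0r.
rewrite exchange_big /=.
transitivity (\sum_(g : gal_of {:L}) \sum_(n < M | is_place n) F (Phi n g)); last first.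
  rewrite exchange_big /=; apply: eq_bigr => n _; apply: eq_bigr => g _.
  by rewrite /F; congr (ln _); apply: eq_bigr => k _; rewrite mxE.
apply: eq_bigr => g _.
transitivity (\sum_(n < M | is_place n) \sum_(v <- V) (Phi n g == v)%:R * F v); last first.
  apply: eq_bigr => n pn; rewrite (bigD1_seq (Phi n g)) ?undup_uniq ?PhiV //= eqxx mul1r.
  rewrite big1 ?addr0 // => v vn.
  by rewrite eq_sym (negPf vn) mul0r.
(* The restriction of [v] to the rationals determines [n], so only one summand survives for each
   [v]. *)
rewrite exchange_big /=; rewrite big_seq [RHS]big_seq; apply: eq_bigr => v /VP[n [g' [nM pn vE]]].
have [_ h2] := conjugate_place g' pn.
rewrite (bigD1 (Ordinal nM)) //= big1 ?addr0.
  congr (_%:R * _); rewrite {1}vE h2 -/(alg_place R n) -/(Phi n g).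
  by case: (Phi n g =P v) => h; [rewrite asboolT|rewrite asboolF].
move=> k /andP[pk kn]; have [e|_] := eqVneq (Phi k g) v; last by rewrite mul0r.
have [_ hk] := conjugate_place g pk.
move: kn; rewrite -val_eqE /= => /eqP[]; apply: (@rat_place_inj R _ _ pk pn).
by rewrite -[LHS]hk -[RHS]h2 e vE.
Unshelve. all: by end_near. Qed.

End HeightFormula.

(** * Weil heights *)

Lemma proj_eqP N (x y : nzvec N) : \pi_(proj N) x = \pi_(proj N) y <->
  exists2 c : algC, c != 0 & val x = c *: val y.
Proof.
split=> [/eqquotP/asboolP//|h]; apply/eqquotP; exact/asboolP.
Qed.

Lemma coords_neq0 N (Q : proj N) : coords Q != 0.
Proof. exact: (valP (repr Q)). Qed.

Lemma pi_coords N (Q : proj N) (x : nzvec N) : \pi_(proj N) x = Q <->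
  exists2 c : algC, c != 0 & val x = c *: coords Q.
Proof. by rewrite -[Q in _ = Q]reprK; exact: proj_eqP. Qed.

(** The coordinates of [Q] generate a number field, so the [get] in [weil_height] returns a value
    attained by some representation. *)
Lemma weil_heightP (R : realType) N (Q : proj N) :
  exists (K : fieldExtType rat) (f : {rmorphism K -> algC}) (x : 'rV[K]_N.+1),
    [/\ x != 0, weil_height R Q = number_field_height R x &
        exists2 c : algC, c != 0 & map_mx f x = c *: coords Q].
Proof.
set S := [set h : R | exists (K : fieldExtType rat) (f : {rmorphism K -> algC})
                     (x : 'rV[K]_N.+1) (nz_fx : map_mx f x != 0),
         \pi_(proj N) (Sub (map_mx f x) nz_fx : nzvec N) = Q /\
         h = number_field_height R x].
have [h Sh] : exists h, S h.
  have [K [f [s1 sE _]]] := num_field_exists [seq coords Q 0 k | k <- enum 'I_N.+1].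
  pose x : 'rV[K]_N.+1 := \row_k s1`_k.
  have xE : map_mx f x = coords Q.
    apply/rowP => k; rewrite !mxE.
    have sz : size s1 = N.+1 by rewrite -(size_map f) sE size_map size_enum_ord.
    rewrite -(nth_map _ 0) ?sz // sE (nth_map ord0) ?size_enum_ord //.
    by rewrite nth_ord_enum.
  have nz : map_mx f x != 0 by rewrite xE coords_neq0.
  exists (number_field_height R x), K, f, x, nz; split=> //.
  by apply/pi_coords; exists 1; rewrite ?oner_eq0 // scale1r SubK.
have : S (weil_height R Q) by exact: (getPex (ex_intro S h Sh)).
move=> [K [f [x [nz [/pi_coords cE ->]]]]].
exists K, f, x; split=> //.
by apply: contra (nz) => /eqP ->; rewrite map_mx0 eqxx.
Qed.

Section HeightProperties.
Variable R : realType.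
Local Notation w := (alg_place R).

Lemma product_formula (L : splittingFieldType rat) (i : {rmorphism L -> algC}) (z : L) :
  z != 0 -> \forall M \near \oo,
    \sum_(n < M | is_place n) \sum_(g : gal_of {:L}) ln (w n (i (g z))) = 0.
Proof.
move=> z0; have [q qE] := gal_norm_rat z.
have q0 : q != 0.
  apply/eqP => q0; move/eqP: qE; rewrite q0 -alg_num_field scale0r prodf_seq_eq0 => /hasP[g _ /=].
  by rewrite -(fmorph_eq0 i) gal_eq0 (negPf z0).
have [M0 _ HM] := rat_place_product_formula R q0.
near=> M; rewrite -[RHS](HM M); last by near: M; exact: nbhs_infty_ge.
apply: eq_bigr => n pn; have wP := alg_place_absv R pn.
rewrite -ln_prod => [|g _]; last by rewrite absv_gt0 // gal_eq0.
by rewrite -absv_prod // -rmorph_prod qE fmorph_rat alg_place_rat.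
Unshelve. all: by end_near. Qed.

(** Each local maximum is at least the term of one fixed nonzero coordinate, whose total vanishes by
    the product formula. *)
Lemma number_field_height_ge0 (K : fieldExtType rat) (f : {rmorphism K -> algC})
  N (x : 'rV[K]_N.+1) : x != 0 -> 0 <= number_field_height R x.
Proof.
move=> x0; have [L [i iP]] := normal_num_field_exists [seq f b | b <- vbasis {:K}].
have [|j jE] := @num_field_embed_basis K L f i.
  by move=> b bK; apply: iP; apply: map_f.
have /rV0Pn[k xk] := x0.
have jxk : j (x 0 k) != 0 by rewrite fmorph_eq0.
have G0 : 0 < #|{: gal_of {:L}}|%:R :> R.
  by rewrite ltr0n; apply/card_gt0P; exists 1%g.
rewrite -(pmulr_rge0 _ G0).
have [M1 _ H1] := number_field_heightE R i j x0.
have [M2 _ H2] := product_formula i jxk.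
rewrite (H1 (M1 + M2)%N) /= ?leq_addr // -[leLHS](H2 (M1 + M2)%N) /= ?leq_addl //.
apply: ler_sum => n pn; apply: ler_sum => g _.
have wP := alg_place_absv R pn.
have pos : 0 < w n (i (g (j (x 0 k)))) by rewrite absv_gt0 // gal_eq0.
have le : w n (i (g (j (x 0 k)))) <= \big[Num.max/0]_l w n (i (g (map_mx j x 0 l))).
  have := le_bigmax 0 (fun l => w n (i (g (map_mx j x 0 l)))) k.
  by rewrite mxE.
by rewrite ler_ln ?posrE // (lt_le_trans pos).
Qed.

Lemma weil_height_ge0 N (Q : proj N) : 0 <= weil_height R Q.
Proof.
have [K [f [x [x0 -> _]]]] := weil_heightP R Q.
exact: number_field_height_ge0.
Qed.

Lemma place_sumZ (L : splittingFieldType rat) (i : {rmorphism L -> algC}) N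
    (c : L) (y : 'rV[L]_N.+1) n : is_place n -> c != 0 -> y != 0 ->
  place_sum R i (c *: y) n =
    \sum_(g : gal_of {:L}) ln (w n (i (g c))) + place_sum R i y n.
Proof.
move=> pn c0 /rV0Pn[k yk]; have wP := alg_place_absv R pn.
rewrite /place_sum -big_split /=; apply: eq_bigr => g _.
have wc : 0 < w n (i (g c)) by rewrite absv_gt0 // gal_eq0.
have -> : \big[Num.max/0]_l w n (i (g ((c *: y) 0 l))) =
    w n (i (g c)) * \big[Num.max/0]_l w n (i (g (y 0 l))).
  rewrite (big_morph _ (fun a b => maxr_pMr a b (ltW wc)) (mulr0 _)).
  by apply: eq_bigr => l _; rewrite mxE !rmorphM absvM.
rewrite lnM ?posrE //; apply: lt_le_trans (le_bigmax _ _ k).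
by rewrite absv_gt0 // gal_eq0.
Qed.

End HeightProperties.

Lemma eval_forms_scale N e (G : forms N) (c : algC) (x : 'rV[algC]_N.+1) :
  homogeneous_forms e G -> eval_forms G (c *: x) = c ^+ e *: eval_forms G x.
Proof.
move=> hG; apply/rowP => k; rewrite !mxE !mevalE mulr_sumr.
rewrite big_seq [RHS]big_seq; apply: eq_bigr => m mG.
have /dhomogP/(_ _ mG) /= <- := hG k.
rewrite mulrCA; congr (_ * _); rewrite mdegE expr_sum -big_split /=.
by apply: eq_bigr => l _; rewrite mxE exprMn.
Qed.

Lemma conjugate_root (L : splittingFieldType rat) (i : {rmorphism L -> algC})
    (q : {poly rat}) (g : gal_of {:L}) (a : L) :
  root (map_poly ratr q) (i a) -> root (map_poly ratr q) (i (g a)).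
Proof.
have e : map_poly ratr q = map_poly i (map_poly (in_alg L) q).
  rewrite -map_poly_comp; apply: eq_map_poly => x /=.
  by rewrite alg_num_field fmorph_rat.
rewrite e !fmorph_root => h.
have e' : map_poly (in_alg L) q = map_poly (gal_repr g) (map_poly (in_alg L) q).
  rewrite -map_poly_comp; apply: eq_map_poly => x /=.
  by rewrite alg_num_field fmorph_rat.
by rewrite e' fmorph_root.
Qed.

(** * Growth of heights under homogeneous forms *)

Section FormsHeightBound.
Variables (R : realType) (N e : nat) (G : forms N).
Hypothesis homG : homogeneous_forms e G.
Local Notation w := (alg_place R).

Definition form_coefs : seq algC :=
  flatten [seq [seq (tnth G k)@_m | m <- msupp (tnth G k)] | k <- enum 'I_N.+1].

Lemma form_coefsP k m : m \in msupp (tnth G k) -> (tnth G k)@_m \in form_coefs.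
Proof.
move=> mG; apply/flatten_mapP; exists k; first by rewrite mem_enum.
exact: map_f.
Qed.

(** The number of terms is the price of the archimedean triangle inequality; the successor keeps its
    logarithm nonnegative. *)
Definition form_terms : nat := (\max_k size (msupp (tnth G k))).+1.

Definition term_bound (n : nat) : R := if n == 0%N then form_terms%:R else 1.

(** Meant for the roots [rs] of a rational polynomial: it then bounds all Galois conjugates of each
    root at once. *)
Definition conj_bound (rs : seq algC) (n : nat) : R :=
  \big[Num.max/1]_(k < size rs) w n rs`_k.

Lemma conj_bound_ge1 rs n : 1 <= conj_bound rs n.
Proof. exact: bigmax_ge_id. Qed.

Lemma term_bound_ge1 n : 1 <= term_bound n.
Proof. by rewrite /term_bound; case: ifP => // _; rewrite ler1n. Qed.

(** The coefficients [a] are free, as conjugates of those of [G] will be inserted; only the support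
    and the degree of [G] matter. *)
Lemma absv_form_le n (k : 'I_N.+1) (a : 'X_{1..N.+1} -> algC) (y : 'I_N.+1 -> algC)
    (B X : R) : is_place n ->
  (forall m, m \in msupp (tnth G k) -> w n (a m) <= B) ->
  (forall l, w n (y l) <= X) -> 0 <= B -> 0 <= X ->
  w n (\sum_(m <- msupp (tnth G k)) a m * \prod_l y l ^+ m l)
    <= term_bound n * B * X ^+ e.
Proof.
move=> pn aB yX B0 X0; have wP := alg_place_absv R pn.
have term m : m \in msupp (tnth G k) ->
    w n (a m * \prod_l y l ^+ m l) <= B * X ^+ e.
  move=> mG; rewrite absvM //; apply: ler_pM; rewrite ?absv_ge0 //; first exact: aB.
  have /dhomogP/(_ _ mG) /= <- := homG k.
  rewrite mdegE expr_sum absv_prod //; apply: ler_prod => l _.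
  rewrite absv_ge0 //= absvX //.
  by rewrite lerXn2r // nnegrE ?absv_ge0.
have BX0 : 0 <= B * X ^+ e by rewrite mulr_ge0 // exprn_ge0.
rewrite /term_bound -mulrA; case: eqP => [n0|n0]; last first.
  rewrite mul1r; apply: (nonarch_sum wP) => // [j|m mG _]; last exact: term.
  by apply: alg_place_nat; move: pn; rewrite /is_place; case: eqP.
apply: le_trans (absv_sum wP _ _ _) _.
apply: (@le_trans _ _ (\sum_(m <- msupp (tnth G k)) B * X ^+ e)).
  by rewrite big_seq [leRHS]big_seq; apply: ler_sum.
rewrite big_const_seq count_predT iter_addr_0 -[leLHS]mulr_natl ler_wpM2r // ler_nat.
by rewrite leqW // (leq_bigmax k).
Qed.

(** The local bound [absv_form_le] is summed over places and automorphisms. For uniformity in [Q],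
    the coefficients are enclosed in the root set of one rational polynomial, which every
    automorphism of every [L] preserves. *)
Lemma forms_height_bound : exists2 C : R, 0 <= C &
  forall Q Q' : proj N,
    (exists2 c, c != 0 & coords Q' = c *: eval_forms G (coords Q)) ->
    weil_height R Q' <= e%:R * weil_height R Q + C.
Proof.
have [q [q0 qs]] := common_rat_poly form_coefs.
have [rs Drs] := closed_field_poly_normal (map_poly ratr q : {poly algC}).
have rootE x : root (map_poly ratr q) x -> exists k : 'I_(size rs), x = rs`_k.
  rewrite Drs rootZ ?lead_coef_eq0 ?map_poly_eq0 // root_prod_XsubC => xr.
  by exists (Ordinal (etrans (index_mem x rs) xr)); rewrite /= nth_index.
pose Cn n := ln (term_bound n) + ln (conj_bound rs n).
have Cn0 n : 0 <= Cn n.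
  by rewrite addr_ge0 // ln_ge0 ?term_bound_ge1 ?conj_bound_ge1.
have Cn_near : \forall n \near \oo, is_place n -> Cn n = 0.
  have h : \forall n \near \oo, forall k : 'I_(size rs), is_place n -> w n rs`_k <= 1.
    by apply: filter_forall => k; exact: alg_place_integral.
  near=> n => pn; have n0 : (0 < n)%N by near: n; exact: nbhs_infty_gt.
  rewrite /Cn /term_bound gtn_eqF // ln1 add0r.
  suff -> : conj_bound rs n = 1 by rewrite ln1.
  apply/eqP; rewrite eq_le conj_bound_ge1 andbT; apply/bigmax_leP; split=> // k _.
  exact: (near h n).
have [M0 _ Cn_ge] := Cn_near.
(* Summing over automorphisms repeats [Cn n] as often as the group order, which is exactly the
   normalisation of the height; so [C] is independent of [L]. *)
pose C := \sum_(n < M0 | is_place n) Cn n.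
have CE M : (M0 <= M)%N -> \sum_(n < M | is_place n) Cn n = C.
  move=> M0M; rewrite /C [RHS](big_ord_widen_cond M) // [RHS]big_mkcondr.
  apply: eq_bigr => n pn; case: ltnP => // h; exact: Cn_ge.
exists C; first exact: sumr_ge0.
move=> Q Q' [c c0 Q'E].
have [K [f [x [x0 hE [c1 c10 xE]]]]] := weil_heightP R Q.
have [K' [f' [x' [x'0 hE' [c2 c20 x'E]]]]] := weil_heightP R Q'.
move: (weil_height R Q) (weil_height R Q') hE hE' => h h' hE hE'.
pose s := [seq f b | b <- vbasis {:K}] ++ [seq f' b | b <- vbasis {:K'}] ++ form_coefs.
have [L [i iP]] := normal_num_field_exists s.
have [|j jE] := @num_field_embed_basis K L f i.
  by move=> b bK; apply: iP; rewrite mem_cat map_f.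
have [|j' j'E] := @num_field_embed_basis K' L f' i.
  by move=> b bK; apply: iP; rewrite !mem_cat map_f ?orbT.
have /choice[inv invP] : forall a, exists b, a \in form_coefs -> i b = a.
  move=> a; have [aC|] := boolP (a \in form_coefs); last by exists 0.
  have as' : a \in s by rewrite !mem_cat aC !orbT.
  by have [b bE] := iP a as'; exists b.
pose y := map_mx j x; pose y' := map_mx j' x'.
pose z : 'rV[L]_N.+1 := \row_k \sum_(m <- msupp (tnth G k))
  inv (tnth G k)@_m * \prod_l y 0 l ^+ m l.
have iy : map_mx i y = c1 *: coords Q.
  rewrite -xE; apply/rowP => k; by rewrite !mxE jE.
have iy' : map_mx i y' = c2 *: coords Q'.
  by rewrite -x'E; apply/rowP => k; rewrite !mxE j'E.
have iz : map_mx i z = eval_forms G (map_mx i y).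
  apply/rowP => k; rewrite !mxE mevalE rmorph_sum /= big_seq [RHS]big_seq.
  apply: eq_bigr => m mG; rewrite rmorphM rmorph_prod /= invP ?form_coefsP //.
  by congr (_ * _); apply: eq_bigr => l _; rewrite rmorphXn !mxE.
have y0 : y != 0 by rewrite map_mx_eq0.
have y'0 : y' != 0 by rewrite map_mx_eq0.
have [c3 c30 y'z] : exists2 c3, c3 != 0 & map_mx i y' = c3 *: map_mx i z.
  exists (c2 * c / c1 ^+ e); first by rewrite !mulf_neq0 ?invr_eq0 ?expf_neq0.
  by rewrite iz iy (eval_forms_scale _ _ homG) iy' Q'E !scalerA mulfVK ?expf_neq0.
(* The proportionality factor is a quotient of coordinates, hence lies in [L], where the product
   formula is available. *)
have [d d0 y'd] : exists2 d, d != 0 & y' = d *: z.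
  have /rV0Pn[k y'k] := y'0.
  have e1 l : i (y' 0 l) = c3 * i (z 0 l).
    by have /rowP/(_ l) := y'z; rewrite !mxE.
  have zk : z 0 k != 0.
    by move: y'k; rewrite -(fmorph_eq0 i) e1 mulf_eq0 (negPf c30) fmorph_eq0.
  exists (y' 0 k / z 0 k); first by rewrite mulf_neq0 ?invr_eq0.
  apply/rowP => l; apply: (fmorph_inj i); rewrite [in RHS]mxE rmorphM fmorph_div /= !e1.
  by rewrite mulfK // fmorph_eq0.
have z0 : z != 0 by apply: contraNneq y'0 => ze; rewrite y'd ze scaler0.
pose g1 := #|{: gal_of {:L}}|%:R : R.
have g10 : 0 < g1 by rewrite ltr0n; apply/card_gt0P; exists 1%g.
have [M1 _ H1] := number_field_heightE R i j x0.
have [M2 _ H2] := number_field_heightE R i j' x'0.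
have [M3 _ H3] := product_formula R i d0.
pose M := (M0 + M1 + M2 + M3)%N.
have M0M : (M0 <= M)%N by rewrite /M -!addnA leq_addr.
have M1M : (M1 <= M)%N by rewrite /M -!addnA addnCA leq_addr.
have M2M : (M2 <= M)%N := leq_trans (leq_addl (M0 + M1) M2) (leq_addr M3 _).
have M3M : (M3 <= M)%N := leq_addl _ _.
have {}H1 : g1 * h = \sum_(n < M | is_place n) place_sum R i y n.
  by rewrite hE; exact: H1.
have {}H2 : g1 * h' = \sum_(n < M | is_place n) place_sum R i y' n.
  by rewrite hE'; exact: H2.
rewrite -(ler_pM2l g10) mulrDr [g1 * (e%:R * _)]mulrCA H1 H2 y'd.
(* The contribution of [d] cancels by the product formula, which leaves [z], the value of the forms
   at [y]. *)
under eq_bigr do rewrite place_sumZ //.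
rewrite big_split /= (H3 M) // add0r -(CE M) //.
rewrite !mulr_sumr -big_split /=; apply: ler_sum => n pn.
have wP := alg_place_absv R pn.
rewrite addrC mulr_natl -[X in _ *+ X]/(#|xpredT|) -sumr_const /place_sum mulr_sumr -big_split /=.
apply: ler_sum => g _.
set X := \big[Num.max/0]_k w n (i (g (y 0 k))).
have X0 : 0 < X.
  have /rV0Pn[k yk] := y0; apply: lt_le_trans (le_bigmax _ _ k).
  by rewrite absv_gt0 // gal_eq0.
have Z0 : 0 < \big[Num.max/0]_k w n (i (g (z 0 k))).
  have /rV0Pn[k zk] := z0; apply: lt_le_trans (le_bigmax _ _ k).
  by rewrite absv_gt0 // gal_eq0.
have B1 : 0 < conj_bound rs n by apply: lt_le_trans (conj_bound_ge1 _ _).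
have T1 : 0 < term_bound n by apply: lt_le_trans (term_bound_ge1 _).
have -> : Cn n + e%:R * ln X = ln (term_bound n * conj_bound rs n * X ^+ e).
  by rewrite !lnM ?posrE ?mulr_gt0 ?exprn_gt0 // lnXn // mulr_natl.
rewrite ler_ln ?posrE ?mulr_gt0 ?exprn_gt0 //.
apply/bigmax_leP; split=> [|k _]; first by rewrite ltW // !mulr_gt0 ?exprn_gt0.
rewrite mxE rmorph_sum rmorph_sum /=.
under eq_bigr do rewrite !rmorphM !rmorph_prod /=.
under eq_bigr do under eq_bigr do rewrite !rmorphXn.
apply: (@absv_form_le n k (fun m => i (g (inv (tnth G k)@_m))) (fun l => i (g (y 0 l)))) => //.
- move=> m mG; have [|kk ->] := rootE (i (g (inv (tnth G k)@_m))).
    by apply: conjugate_root; rewrite invP ?form_coefsP // qs // form_coefsP.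
  exact: (le_bigmax _ (fun kk : 'I_(size rs) => w n rs`_kk) kk).
- by move=> l; exact: (le_bigmax _ (fun l => w n (i (g (y 0 l)))) l).
- exact: ltW.
- exact: ltW.
Unshelve. all: by end_near. Qed.

End FormsHeightBound.

(** * Dynamics *)

Section Dynamics.
Variables (R : realType) (N : nat) (phi : ratmap N).
Local Notation F := (ratmap_forms phi).
Local Notation h := (weil_height R).

Lemma eval_iter_forms n (x : 'rV[algC]_N.+1) :
  eval_forms (iter_forms F n.+1) x = eval_forms F (eval_forms (iter_forms F n) x).
Proof.
apply/rowP => k; rewrite !mxE /= tnth_mktuple comp_mpoly_meval.
by apply: meval_eq => l; rewrite mxE.
Qed.

Lemma coords_app (Q : proj N) : ~ indeterminacy phi Q ->
  exists2 c, c != 0 & coords (app phi Q) = c *: eval_forms F (coords Q).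
Proof.
move=> /eqP nz; rewrite /app.
case: insubP => [y _ yE|]; last by rewrite nz.
have /pi_coords[c c0 cE] : \pi_(proj N) y = \pi_(proj N) y by [].
exists c^-1; first by rewrite invr_eq0.
by rewrite -yE cE scalerA mulVf // scale1r.
Qed.

Lemma good_orbit_iter n (Q : proj N) :
  good_orbit phi Q -> good_orbit phi (iter n (app phi) Q).
Proof.
move=> /= gQ; rewrite /good_orbit /= -subset0 => S [[m _ <-] iS].
have : (Defs.orbit phi Q `&` indeterminacy phi) (iter m (app phi) (iter n (app phi) Q)).
  by split=> //; exists (m + n)%N => //; rewrite iterD.
by rewrite gQ.
Qed.

Lemma coords_iter n (Q : proj N) : good_orbit phi Q ->
  exists2 c, c != 0 &
    coords (iter n (app phi) Q) = c *: eval_forms (iter_forms F n) (coords Q).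
Proof.
move=> gQ; elim: n => [|n [c c0 cE]].
  exists 1; rewrite ?oner_eq0 // scale1r; apply/rowP => k.
  by rewrite mxE /= tnth_mktuple mevalXU.
have [|d d0 dE] := @coords_app (iter n (app phi) Q).
  move=> iQ; have : (Defs.orbit phi Q `&` indeterminacy phi) (iter n (app phi) Q).
    by split=> //; exists n.
  by rewrite gQ.
exists (d * c ^+ ratmap_deg phi); first by rewrite mulf_neq0 ?expf_neq0.
by rewrite iterS dE cE (eval_forms_scale _ _ (@ratmap_homog _ phi)) eval_iter_forms scalerA.
Qed.

(* [get] returns [0] on an empty set of degrees, so a positive [deg_iter] comes
   with forms without common factor. *)
Lemma iter_height_bound k : (0 < deg_iter phi k)%N -> exists2 C : R, 0 <= C &
  forall Q, good_orbit phi Q ->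
    h (iter k (app phi) Q) <= (deg_iter phi k)%:R * h Q + C.
Proof.
rewrite /deg_iter /map_degree; set S := [set e | _] => S0.
have [e Se] : exists e, S e.
  apply: contrapT => nS; move: S0; rewrite getPN //.
  by move=> e Se; apply: nS; exists e.
have : S (get S) by exact: (getPex (ex_intro S e Se)).
case=> G [homG _ [H H0 HE]].
have [C C0 HC] := forms_height_bound R homG.
exists C => // Q gQ; apply: HC.
have [c c0 cE] := coords_iter k gQ.
have evE : eval_forms (iter_forms F k) (coords Q) =
    H.@[fun l => coords Q 0 l] *: eval_forms G (coords Q).
  by apply/rowP => l; rewrite !mxE HE mevalM.
exists (c * H.@[fun l => coords Q 0 l]); last by rewrite cE evE scalerA.
(* The cancelled factor [H] cannot vanish at [Q]: the coordinates of the [k]-th image would all be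
   zero. *)
apply: contraNneq (coords_neq0 (iter k (app phi) Q)) => e0.
by rewrite cE evE scalerA e0 scale0r.
Qed.

Hypothesis delta_gt1 : 1 < dyn_degree R phi.

(* [limn] is [0] on a divergent sequence. *)
Lemma dyn_degree_cvg :
  (fun n : nat => (deg_iter phi n)%:R `^ n%:R^-1 : R) @ \oo --> dyn_degree R phi.
Proof.
apply: contrapT => ncv; have e := dvgP ncv; move: delta_gt1; rewrite /dyn_degree e.
by rewrite ltNge ler01.
Qed.

(* A step [k] with [D ^ (1 / k) < r], where [D] is the degree of the [k]-th
   iterate, gives [h (phi^(m + k) P) <= D * h (phi^m P) + C]; iterate. *)
Lemma height_iter_le (P : proj N) (r : R) : good_orbit phi P ->
  dyn_degree R phi < r ->
  exists2 B, 0 < B & exists2 s, 1 < s < r &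
    forall m, height_iter R phi P m <= B * s ^+ m.
Proof.
move=> gP dr.
have h1 : \forall k \near \oo, 1 < (deg_iter phi k)%:R `^ k%:R^-1 :> R.
  exact: (cvgr_gt _ dyn_degree_cvg).
have h2 : \forall k \near \oo, (deg_iter phi k)%:R `^ k%:R^-1 < r.
  exact: (cvgr_lt _ dyn_degree_cvg).
(* The successor makes the step positive, so that the [k]-th root can be undone and passing to
   [m - k] is a descent. *)
have [k0 _ /(_ k0.+1)] := filterI h1 h2.
set k := k0.+1; rewrite /= leqnSn => /(_ isT).
set s := _ `^ _ => -[s1 sr].
pose D : R := (deg_iter phi k)%:R.
have D0 : 0 <= D by [].
have sD : s ^+ k = D.
  by rewrite -powR_mulrn ?powR_ge0 // -powRrM mulVf ?pnatr_eq0 // powRr1.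
have D1 : 1 < D by rewrite -sD exprn_egt1.
have Dpos : (0 < deg_iter phi k)%N by move: D1; rewrite ltr1n; exact: ltn_trans.
have [C C0 HC] := iter_height_bound Dpos.
pose a m := height_iter R phi P m.
have a0 m : 0 <= a m by exact: weil_height_ge0.
have step m : a (m + k)%N <= D * a m + C.
  by rewrite /a /height_iter addnC iterD; apply: HC; exact: good_orbit_iter.
pose B := \sum_(l < k) (a l + C) + 1.
have B1 : 1 <= B by rewrite lerDr sumr_ge0 // => l _; rewrite addr_ge0.
have B0 : 0 < B by apply: lt_le_trans B1.
have s0 : 0 < s by apply: lt_trans s1.
exists B => //; exists s; first by rewrite s1.
(* Carrying [C] along closes the induction: the integer [D > 1] is at least 2, so
   [D * a + C + C <= D * (a + C)]. *)
suff bnd m : a m + C <= B * s ^+ m.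
  by move=> m; apply: le_trans (bnd m); rewrite lerDl.
have [n] := ubnP m; elim: n m => // n IH m; rewrite ltnS => mn.
have [mk|km] := ltnP m k.
  apply: (@le_trans _ _ B); last by rewrite ler_peMr ?(ltW B0) // exprn_ege1 // ltW.
  rewrite /B (bigD1 (Ordinal mk)) //= -addrA lerDl addr_ge0 //.
  by apply: sumr_ge0 => l _; rewrite addr_ge0.
have mE : m = (m - k + k)%N by rewrite subnK.
have ih : a (m - k)%N + C <= B * s ^+ (m - k).
  by apply: IH; apply: leq_trans mn; rewrite ltn_subrL /= (leq_trans _ km).
rewrite mE exprD sD mulrA.
apply: (@le_trans _ _ (D * a (m - k)%N + C + C)); first by rewrite lerD2r step.
apply: (@le_trans _ _ ((a (m - k)%N + C) * D)); last by rewrite ler_wpM2r.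
have D2 : 2 <= D by move: D1; rewrite ltr1n ler_nat.
have : 0 <= (D - 2) * C by rewrite mulr_ge0 // subr_ge0.
by move: (a _) => am; lra.
Qed.

End Dynamics.

(** * Limits superior of extended real sequences *)

Section LimnEsup.
Variable R : realType.
Implicit Types u v : nat -> \bar R.

Lemma limn_esup_le_near u (x : \bar R) :
  (\forall n \near \oo, (u n <= x)%E) -> (limn_esup u <= x)%E.
Proof.
move=> ux; rewrite /limn_esup limf_esupE.
apply: (@le_trans _ _ (ereal_sup (u @` [set n | (u n <= x)%E]))).
  by apply: ereal_inf_lbound; exists [set n | (u n <= x)%E].
by apply: ge_ereal_sup => _ [n un <-].
Qed.

Lemma limn_esup_ge_frequently u (x : \bar R) :
  (forall m, exists2 n, (m <= n)%N & (x <= u n)%E) -> (x <= limn_esup u)%E.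
Proof.
move=> h; rewrite /limn_esup limf_esupE; apply: le_ereal_inf_tmp.
move=> _ [V [m _ mV] <-]; have [n mn xu] := h m.
by apply: le_trans xu _; apply: ereal_sup_ubound; exists n => //; exact: mV.
Qed.

Lemma limn_esup_gt_frequently u (x : \bar R) : (x < limn_esup u)%E ->
  forall m, exists2 n, (m <= n)%N & (x < u n)%E.
Proof.
move=> xu m; apply: contrapT => nh; move: xu; rewrite ltNge => /negP; apply.
apply: limn_esup_le_near; exists m => // n /= mn; rewrite leNgt; apply/negP => xn.
by apply: nh; exists n.
Qed.

Lemma limn_esup_lt_near u (x : \bar R) : (limn_esup u < x)%E ->
  \forall n \near \oo, (u n < x)%E.
Proof.
move=> ux; apply: contrapT => nn; move: ux; rewrite ltNge => /negP; apply.
apply: limn_esup_ge_frequently => m; apply: contrapT => nh; apply: nn.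
exists m => // n /= mn; rewrite ltNge; apply/negP => xn.
by apply: nh; exists n.
Qed.

Lemma limn_esup_shift u : limn_esup (fun n => u n.+1) = limn_esup u.
Proof.
apply/eqP; rewrite eq_le; apply/andP; split.
- rewrite [leRHS]/limn_esup limf_esupE; apply: le_ereal_inf_tmp.
  move=> _ [V [m _ mV] <-]; apply: limn_esup_le_near; exists m => // n /= mn.
  by apply: ereal_sup_ubound; exists n.+1 => //; apply: mV; exact: leqW.
- rewrite [leRHS]/limn_esup limf_esupE; apply: le_ereal_inf_tmp.
  move=> _ [V [m _ mV] <-]; apply: limn_esup_le_near; exists m.+1 => // -[|n] //= mn.
  by apply: ereal_sup_ubound; exists n => //; exact: mV.
Qed.

(** The slack [c < c'] is there for weights such as [n ^ - ell], whose consecutive values agree only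
    up to a factor tending to 1. *)
Lemma limn_esup_scale_le (u v : nat -> R) (c : R) : 0 < c -> (forall n, 0 <= u n) ->
  (forall c', c < c' -> \forall n \near \oo, v n <= c' * u n) ->
  (limn_esup (fun n => (v n)%:E) <= c%:E * limn_esup (fun n => (u n)%:E))%E.
Proof.
move=> c0 u0 vu; have : (0 <= limn_esup (fun n => (u n)%:E))%E.
  by apply: limn_esup_ge_frequently => m; exists m => //; rewrite lee_fin.
case E : (limn_esup (fun n => (u n)%:E)) => [s| |] // s0.
- rewrite lee_fin in s0; rewrite -EFinM; apply/lee_addgt0Pr => e e0.
  pose d := c + s + 1; have d0 : 0 < d by rewrite /d; lra.
  (* Since [t <= 1], the excess of [(c + t) * (s + t)] over [c * s] is at most [t * (c + s + 1)],
     hence at most [e]. *)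
  pose t := Num.min 1 (e / d).
  have t0 : 0 < t by rewrite lt_min ltr01 divr_gt0.
  have t1 : t <= 1 by rewrite ge_min lexx.
  have td : t * d <= e by rewrite -ler_pdivlMr // ge_min lexx orbT.
  apply: (@le_trans _ _ ((c + t) * (s + t))%:E); last first.
    rewrite -EFinD lee_fin; move: td; rewrite /d => td.
    have : t * t <= t by rewrite ler_piMl // ltW.
    by move: (t * t) td => tt td; nra.
  have hv : \forall n \near \oo, v n <= (c + t) * u n by apply: vu; rewrite ltrDl.
  have hu : \forall n \near \oo, ((u n)%:E < (s + t)%:E)%E.
    by apply: limn_esup_lt_near; rewrite E lte_fin ltrDl.
  apply: limn_esup_le_near; near=> n; rewrite lee_fin.
  apply: (@le_trans _ _ ((c + t) * u n)); first exact: (near hv n).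
  rewrite ler_wpM2l ?addr_ge0 ?(ltW t0) // ltW // -lte_fin; exact: (near hu n).
- by rewrite gt0_muley ?leey // lte_fin.
Unshelve. all: by end_near. Qed.

End LimnEsup.

(** * Canonical height and arithmetic degree *)

Section CanonicalHeight.
Variables (R : realType) (N : nat) (phi : ratmap N).
Hypotheses (delta_gt1 : 1 < dyn_degree R phi) (ell_exists : ell_set R phi !=set0).
Local Notation delta := (dyn_degree R phi).
Local Notation ell := (ell R phi).

Let d0 : 0 < delta. Proof. exact: lt_trans delta_gt1. Qed.

Lemma ell_ge0 : 0 <= ell.
Proof. by apply: lb_le_inf => // l []. Qed.

Let a (P : proj N) (n : nat) : R :=
  n%:R `^ (- ell) * delta ^- n * height_iter R phi P n.

Lemma height_iter_ge0 P n : 0 <= height_iter R phi P n.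
Proof. exact: weil_height_ge0. Qed.

Let a_ge0 P n : 0 <= a P n.
Proof.
by rewrite !mulr_ge0 ?powR_ge0 ?height_iter_ge0 // invr_ge0 exprn_ge0 // ltW.
Qed.

Lemma canonical_height_ge0 P : (0 <= canonical_height R phi P)%E.
Proof.
apply: limn_esup_ge_frequently => m; exists m => //.
by rewrite lee_fin; exact: a_ge0.
Qed.

(** The ratio is [(1 + 1 / n) ^ ell], whose logarithm is at most [ell / n]; this is below [ln c]
    once [n >= ell / ln c]. *)
Lemma powR_succ_near (c : R) : 1 < c -> \forall n \near \oo,
  n%:R `^ (- ell) <= c * n.+1%:R `^ (- ell).
Proof.
move=> c1; have lc : 0 < ln c by rewrite ln_gt0.
near=> n; have n0 : (0 < n)%N by near: n; exact: nbhs_infty_gt.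
have nR : 0 < n%:R :> R by rewrite ltr0n.
have nl : ell / ln c <= n%:R by near: n; exact: nbhs_infty_ger.
have -> : n.+1%:R = n%:R * (1 + n%:R^-1) :> R.
  by rewrite mulrDr mulr1 mulfV ?gt_eqF // natr1.
have p1 : 0 < 1 + n%:R^-1 :> R by rewrite addr_gt0 // invr_gt0.
rewrite powRM ?(ltW nR) ?(ltW p1) // mulrCA ler_peMr ?powR_ge0 //.
rewrite (powRN _ ell) -[leRHS]/(_ / _) ler_pdivlMr ?powR_gt0 // mul1r.
rewrite -[leRHS]lnK ?posrE ?(lt_trans ltr01) // -[leLHS]lnK ?posrE ?powR_gt0 //.
rewrite ler_expR ln_powR; apply: (@le_trans _ _ (ell * n%:R^-1)).
  by rewrite ler_wpM2l ?ell_ge0 // le_ln1Dx // (lt_trans (ltrN10 R)) ?invr_gt0.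
by rewrite ler_pdivrMr // mulrC -ler_pdivrMr.
Unshelve. all: by end_near. Qed.

(** Shifting the index changes the weight from [n ^ - ell] to [(n + 1) ^ - ell]. The upper bound
    absorbs the ratio by [powR_succ_near]; for the lower bound it suffices that the weight
    decreases. *)
Lemma canonical_height_app P :
  canonical_height R phi (app phi P) = (delta%:E * canonical_height R phi P)%E.
Proof.
have hE n : height_iter R phi (app phi P) n = height_iter R phi P n.+1.
  by rewrite /height_iter iterSr.
have bE n : a (app phi P) n = n%:R `^ (- ell) * delta ^- n * height_iter R phi P n.+1.
  by rewrite /a hE.
have dX n : delta ^- n = delta * delta ^- n.+1.
  by rewrite exprS invfM mulrA mulfV ?gt_eqF // mul1r.
have chE Q : canonical_height R phi Q = limn_esup (fun n => (a Q n)%:E) by [].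
rewrite !chE -[in RHS](limn_esup_shift (fun n => (a P n)%:E)).
apply/eqP; rewrite eq_le; apply/andP; split.
  apply: (@limn_esup_scale_le _ (fun n => a P n.+1) (a (app phi P))) => // c' cc'.
  have c1 : 1 < c' / delta by rewrite ltr_pdivlMr // mul1r.
  have := powR_succ_near c1; apply: filterS => n hn.
  rewrite bE /a dX.
  have -> : c' * (n.+1%:R `^ (- ell) * delta ^- n.+1 * height_iter R phi P n.+1) =
     (c' / delta * n.+1%:R `^ (- ell)) * (delta * delta ^- n.+1) * height_iter R phi P n.+1.
    by field; rewrite !lt0r_neq0 ?exprn_gt0.
  rewrite ler_wpM2r ?height_iter_ge0 // ler_wpM2r //.
  by rewrite -dX invr_ge0 exprn_ge0 // ltW.
have : (limn_esup (fun n => (a P n.+1)%:E) <=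
    (delta^-1)%:E * limn_esup (fun n => (a (app phi P) n)%:E))%E.
  apply: (@limn_esup_scale_le _ (a (app phi P)) (fun n => a P n.+1)) => [|//|c' cc'].
    by rewrite invr_gt0.
  have c0 : 0 < c' by apply: lt_trans cc'; rewrite invr_gt0.
  near=> n; have n0 : (0 < n)%N by near: n; exact: nbhs_infty_gt.
  apply: (@le_trans _ _ (delta^-1 * a (app phi P) n)); last first.
    by rewrite ler_wpM2r ?a_ge0 // ltW.
  rewrite bE /a [leRHS]mulrA ler_wpM2r ?height_iter_ge0 // [leRHS]mulrCA exprS invfM.
  rewrite ler_wpM2r ?mulr_ge0 ?invr_ge0 ?exprn_ge0 ?(ltW d0) //.
  rewrite !(powRN _ ell) lef_pV2 ?posrE ?powR_gt0 ?ltr0n //.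
  by apply: ge0_ler_powR; rewrite ?ell_ge0 ?nnegrE // ler_nat.
move=> h; rewrite -[leRHS]mul1e -(@divff _ delta) ?gt_eqF // EFinM -muleA.
by apply: lee_wpmul2l => //; rewrite lee_fin ltW.
Unshelve. all: by end_near. Qed.

(** Heights are bounded along a finite orbit, while the weights are at most [delta ^ - n] for
    [n >= 1]. *)
Lemma canonical_height_preperiodic P :
  preperiodic phi P -> canonical_height R phi P = 0.
Proof.
move=> /finite_seqP[s sE].
pose B := \sum_(Q <- s) weil_height R Q.
have hB n : height_iter R phi P n <= B.
  have : (Defs.orbit phi P) (iter n (app phi) P) by exists n.
  rewrite sE /= => Qs; rewrite /B (big_rem _ Qs) /= lerDl.
  by apply: sumr_ge0 => Q _; exact: weil_height_ge0.
have B0 : 0 <= B by apply: le_trans (hB 0%N); exact: height_iter_ge0.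
apply/eqP; rewrite eq_le canonical_height_ge0 andbT; apply/lee_addgt0Pr => e e0.
rewrite add0e; apply: limn_esup_le_near.
have cv : (fun n => B * delta^-1 ^+ n) @ \oo --> B * 0.
  apply: cvgMr; apply: cvg_expr.
  by rewrite ger0_norm ?invr_ge0 ?(ltW d0) // invf_lt1.
rewrite mulr0 in cv.
near=> n; have n0 : (0 < n)%N by near: n; exact: nbhs_infty_gt.
rewrite lee_fin; apply: (@le_trans _ _ (B * delta^-1 ^+ n)); last first.
  by apply: ltW; near: n; exact: (cvgr_lt _ cv).
rewrite mulrC; apply: ler_pM; rewrite ?height_iter_ge0 //.
  by rewrite mulr_ge0 ?powR_ge0 // invr_ge0 exprn_ge0 // ltW.
rewrite exprVn ler_piMl ?invr_ge0 ?exprn_ge0 ?(ltW d0) //.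
rewrite (powRN _ ell) invf_le1 ?powR_gt0 ?ltr0n //.
by rewrite -[leLHS](powRr0 n%:R); apply: ler_powR; rewrite ?ell_ge0 // ler1n.
Unshelve. all: by end_near. Qed.

Lemma expr_absorb (B r s : R) : 0 < r -> r < s ->
  \forall n \near \oo, B * r ^+ n <= s ^+ n.
Proof.
move=> r0 rs; have s0 : 0 < s by apply: lt_trans rs.
have cv : (fun n => B * (r / s) ^+ n) @ \oo --> B * 0.
  apply: cvgMr; apply: cvg_expr.
  by rewrite ger0_norm ?divr_ge0 ?ltW // ltr_pdivrMr // mul1r.
rewrite mulr0 in cv.
have : \forall n \near \oo, B * (r / s) ^+ n < 1 by exact: (cvgr_lt _ cv).
apply: filterS => n.
rewrite exprMn exprVn mulrA ltr_pdivrMr ?exprn_gt0 // mul1r; exact: ltW.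
Qed.

Lemma arithmetic_degree_eq P : good_orbit phi P -> (0 < canonical_height R phi P)%E ->
  arithmetic_degree R phi P = delta%:E.
Proof.
move=> gP hpos; rewrite /arithmetic_degree.
have [c c0 ch] : exists2 c : R, 0 < c & (c%:E < canonical_height R phi P)%E.
  move: hpos; case: (canonical_height R phi P) => [x| |] //.
    by rewrite lte_fin => x0; exists (x / 2); rewrite ?lte_fin; lra.
  by exists 1 => //; rewrite ltry.
have large m : exists2 n, (m <= n)%N & c * delta ^+ n < height_iter R phi P n.
  have [n mn] := limn_esup_gt_frequently ch m.+1; rewrite lte_fin => cn.
  exists n; first exact: ltnW.
  have n0 : (0 < n)%N by apply: leq_trans mn.
  have dn : 0 < delta ^+ n by rewrite exprn_gt0.
  rewrite -ltr_pdivlMr // mulrC; apply: lt_le_trans cn _.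
  rewrite ler_wpM2r ?height_iter_ge0 // ler_piMl ?invr_ge0 ?(ltW dn) //.
  rewrite (powRN _ ell) invf_le1 ?powR_gt0 ?ltr0n //.
  by rewrite -[leLHS](powRr0 n%:R); apply: ler_powR; rewrite ?ell_ge0 // ler1n.
(* Heights above [c * delta ^ n > 0] recur forever, so the convention for eventually zero heights
   does not apply. *)
case: ifPn => [/asboolP[m _ hm]|_].
  have [n mn] := large m; rewrite hm // ltNge mulr_ge0 ?exprn_ge0 // ltW //.
have root_le (r : R) n : 0 <= r -> (0 < n)%N -> (r ^+ n) `^ n%:R^-1 = r.
  move=> r0 n0; rewrite -powR_mulrn // -powRrM mulfV ?powRr1 //.
  by rewrite pnatr_eq0 -lt0n.
apply/eqP; rewrite eq_le; apply/andP; split.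
  apply/lee_addgt0Pr => e e0; apply: limn_esup_le_near.
  have [|B B0 [s /andP[s1 sr] hB]] := @height_iter_le R N phi delta_gt1 P (delta + e) gP.
    by rewrite ltrDl.
  have s0 : 0 < s by apply: lt_trans s1.
  (* The gap between [s] and [delta + e] absorbs [B] before roots are taken. *)
  have absb := expr_absorb B s0 sr.
  near=> n; have n0 : (0 < n)%N by near: n; exact: nbhs_infty_gt.
  rewrite -EFinD lee_fin -[leRHS](root_le _ n) ?addr_ge0 ?(ltW d0) ?(ltW e0) //.
  apply: ge0_ler_powR; rewrite ?nnegrE ?height_iter_ge0 ?exprn_ge0 ?addr_ge0 ?(ltW d0) ?(ltW e0) //.
  by apply: le_trans (hB n) _; exact: (near absb n).
apply/lee_subgt0Pr => e e0.
(* The second argument keeps [r] positive when [e >= delta]; the gap [r < delta] absorbs [c]. *)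
have dp := d0; pose r := Num.max (delta - e) (delta / 2).
have r0 : 0 < r by rewrite lt_max divr_gt0 ?orbT.
have rd : r < delta by rewrite gt_max; apply/andP; split; [rewrite ltrBlDr ltrDl|rewrite ltr_pdivrMr // ltr_pMr // ltr1n].
have [m _ absb] := expr_absorb c^-1 r0 rd.
apply: limn_esup_ge_frequently => k.
have [n mn hn] := large (m + k).+1.
have n0 : (0 < n)%N by apply: leq_trans mn.
exists n; first by apply: leq_trans (leq_addl m k) (ltnW mn).
rewrite -EFinB lee_fin; apply: (@le_trans _ _ r); first by rewrite le_max lexx.
rewrite -[leLHS](root_le _ n) ?(ltW r0) //.
apply: ge0_ler_powR; rewrite ?nnegrE ?height_iter_ge0 ?exprn_ge0 ?(ltW r0) //.
apply: le_trans (ltW hn); rewrite -ler_pdivrMl //; apply: absb => /=.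
exact: leq_trans (leq_addr k m) (ltnW mn).
Unshelve. all: by end_near. Qed.

End CanonicalHeight.

Local Open Scope ereal_scope.

Theorem proposition19 (R : realType) (N : nat) (phi : ratmap N)
    (phi_dominant : dominant phi)
    (delta_gt1 : (1 < dyn_degree R phi)%R)
    (ell_exists : ell_set R phi !=set0)
    (P : proj N) (P_good : good_orbit phi P) :
  [/\ 0 <= canonical_height R phi P <= +oo,
      canonical_height R phi (app phi P)
        = (dyn_degree R phi)%:E * canonical_height R phi P,
      preperiodic phi P -> canonical_height R phi P = 0 &
      0 < canonical_height R phi P ->
        arithmetic_degree R phi P = (dyn_degree R phi)%:E].
Proof.
split.
- by apply/andP; split; [exact: canonical_height_ge0|exact: leey].
- exact: canonical_height_app.
- exact: canonical_height_preperiodic.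
- exact: arithmetic_degree_eq.
Qed.
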